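(* Suppose $f:\mathbb{R}^d\to\mathbb{R}$ is continuously differentiable with $L$-Lipschitz continuous gradient, and let $f^*=\min_{x\in\mathbb{R}^d}f(x)$. Let $\epsilon>0$, $\delta_1>0$, $\epsilon_S\in(0,3/4)$ and $l\in\mathbb{N}^+$ be such that $$\delta_S<\frac{c}{(c+1)^2},\qquad\left[(1-\delta_S)(1-\delta_1)-1+\frac{c}{(c+1)^2}\right]^{-1}>0,$$ where $\delta_S=e^{-\frac{l(\epsilon_S-1/4)^2}{C_3}}$ and $C_3$ is the problem-independent constant given in the context. Run the random subspace quadratic regularisation algorithm of the context, with $\mathcal{S}$ the distribution of stable 1-hashing matrices in $\mathbb{R}^{l\times d}$, for $N$ iterations with $$N\ge\left[(1-\delta_S)(1-\delta_1)-1+\frac{c}{(c+1)^2}\right]^{-1}\left[\frac{f(x_0)-f^*}{h(\epsilon,\alpha_0\gamma_1^{c+\tau_\alpha})}+\frac{\tau_\alpha}{1+c}\right],$$ where $$h(\epsilon,\alpha_0\gamma_1^{c+\tau_\alpha})=\frac{\theta(1-\epsilon_S)\epsilon^2}{2\alpha_{\max}\left(\sqrt{\lceil d/l\rceil}\left(B_{max}+\alpha_0^{-1}\gamma_1^{-c-\tau_\alpha}\right)+\kappa_T\right)^2},$$ $$\tau_\alpha=\left\lceil\log_{\gamma_1}\left(\min\left\{\frac{\alpha_{low}}{\alpha_0},\frac1{\gamma_2}\right\}\right)\right\rceil,\qquad\alpha_{low}=\frac{1-\theta}{L+B_{max}}.$$ Then $$\mathbb{P}(N\ge N_\epsilon)\ge1-e^{-\frac{\delta_1^2}{2}(1-\delta_S)N},\qquad\text{where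 }N_\epsilon=\min\{k:\|\nabla f(x_k)\|_2\le\epsilon\}.$$
   Context: Stable 1-hashing matrix ($l<d$): $S\in\mathbb{R}^{l\times d}$ has one non-zero per column, equal to $\pm1$ with equal probability; the row indices of the non-zeros of columns $1,\dots,d$ are obtained by randomly sampling $d$ elements without replacement from the multiset consisting of $\{1,\dots,l\}$ repeated $\lceil d/l\rceil$ times. Constant $C_3$: the problem-independent constant of the embedding result for stable 1-hashing matrices used here, which states: if $\epsilon_S\in(0,3/4)$ and $e^{-l(\epsilon_S-1/4)^2/C_3}\in(0,1/2)$, then for each fixed $y\in\{\nabla f(x):x\in\mathbb{R}^d\}$ a stable 1-hashing matrix $S\in\mathbb{R}^{l\times d}$ satisfies $\mathbb{P}(\|Sy\|_2^2\ge(1-\epsilon_S)\|y\|_2^2)\ge1-e^{-l(\epsilon_S-1/4)^2/C_3}$. Random subspace quadratic regularisation algorithm. Parameters: a distribution $\mathcal{S}$ of matrices in $\mathbb{R}^{l\times d}$, $\gamma_1\in(0,1)$, $\gamma_2=\gamma_1^{-c}$ for some $c\in\mathbb{N}^+$, $\theta\in(0,1)$, $\alpha_{\max},B_{max}>0$, $\kappa_T\ge0$, $x_0\in\mathbb{R}^d$, $\alpha_0=\alpha_{\max}\gamma_1^p$ for some $p\in\mathbb{N}^+$. At each iteration $k=0,1,\dots$: 1. Draw $S_k$ from $\mathcal{S}$, independently of all previous iterations. Let $\hat m_k(\hat s)=f(x_k)+\langle S_k\nabla f(x_k),\hat s\rangle+\frac12\langle\hat s,S_kB_kS_k^T\hat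 s\rangle$ for $\hat s\in\mathbb{R}^l$, where $B_k\in\mathbb{R}^{d\times d}$ is a user-provided positive semi-definite matrix with $\|B_k\|_2\le B_{max}$. With $\hat l_k(\hat s)=\hat m_k(\hat s)+\frac1{2\alpha_k}\|S_k^T\hat s\|_2^2$, compute $\hat s_k$ such that $\|\nabla\hat l_k(\hat s_k)\|_2\le\kappa_T\|S_k^T\hat s_k\|_2$ and $\hat l_k(\hat s_k)\le\hat l_k(0)$, and set $s_k=S_k^T\hat s_k$. 2. Sufficient decrease test: $f(x_k)-f(x_k+s_k)\ge\theta[\hat m_k(0)-\hat m_k(\hat s_k)]$. 3. If the test holds, set $x_{k+1}=x_k+s_k$, $\alpha_{k+1}=\min\{\alpha_{\max},\gamma_2\alpha_k\}$; otherwise $x_{k+1}=x_k$, $\alpha_{k+1}=\gamma_1\alpha_k$. *)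

(* Defs.v *)
(* MathComp / MathComp-Analysis *)
From HB Require Import structures.
From mathcomp Require Import all_boot all_order all_algebra.
From mathcomp Require Import all_classical all_reals all_analysis.

Set Implicit Arguments.
Unset Strict Implicit.
Unset Printing Implicit Defensive.

Import Order.TTheory GRing.Theory Num.Theory.
Import numFieldNormedType.Exports.

Local Open Scope classical_set_scope.
Local Open Scope ring_scope.

Definition dot (R : realType) (n : nat) (u v : 'cV[R]_n) : R :=
  \sum_i u i 0 * v i 0.

(* The norm carried by the library's instance on matrices is the max norm, so
   the Euclidean and spectral norms are introduced separately. *)
Definition norm2 (R : realType) (n : nat) (u : 'cV[R]_n) : R :=
  Num.sqrt (dot u u).

Definition opnorm2 (R : realType) (m n : nat) (A : 'M[R]_(m, n)) : R :=
  sup [set norm2 (A *m u) | u in [set u | norm2 u <= 1]].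

Definition psd (R : realType) (n : nat) (A : 'M[R]_n) : Prop :=
  A^T = A /\ forall u : 'cV[R]_n, 0 <= dot u (A *m u).

Definition grad (R : realType) (n : nat) (f : 'cV[R]_n -> R) (x : 'cV[R]_n) :
    'cV[R]_n :=
  \col_i 'D_(delta_mx i 0) f x.

Definition ceil_div (d l : nat) : nat := ((d + l).-1 %/ l)%N.

(* Sampling [d] elements without replacement from the multiset formed by
   [ceil_div d l] copies of [{1, ..., l}] is drawing uniformly an injection of
   the columns into the labelled copies [(row, copy)]; the signs are an
   independent uniform vector of bits. *)
Definition hash_sample (d l : nat) : finType :=
  ({ffun 'I_d -> 'I_l * 'I_(ceil_div d l)} * {ffun 'I_d -> bool})%type.

Definition hash_samples (d l : nat) : {set hash_sample d l} :=
  [set w : hash_sample d l | injectiveb (fun j => w.1 j)].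

Definition hash_mx (R : realType) (d l : nat) (w : hash_sample d l) :
    'M[R]_(l, d) :=
  \matrix_(i, j) (if (w.1 j).1 == i then (-1) ^+ w.2 j else 0).

Definition stable_hashing_law (R : realType) (d l : nat)
    (A : set 'M[R]_(l, d)) : \bar R :=
  (#|[set w in hash_samples d l | hash_mx R w \in A]|%:R
     / #|hash_samples d l|%:R)%:E.

Definition hash_failure (R : realType) (C3 : R) (l : nat) (epsS : R) : R :=
  expR (- (l%:R * (epsS - 4^-1) ^+ 2 / C3)).

Definition stable_hashing_embedding (R : realType) (C3 : R) (d l : nat)
    (f : 'cV[R]_d -> R) (epsS : R) : Prop :=
  0 < epsS < 3 / 4 ->
  0 < hash_failure C3 l epsS < 1 / 2 ->
  forall y, range (grad f) y ->
    ((1 - hash_failure C3 l epsS)%R%:E <= stable_hashing_law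
      [set S : 'M[R]_(l, d) |
        (norm2 (S *m y) ^+ 2 >= (1 - epsS) * norm2 y ^+ 2)%R])%E.

Definition borel_mx (R : realType) (m n : nat) :=
  g_sigma_algebraType (@open 'M[R]_(m, n)).

Definition model (R : realType) (d l : nat) (f : 'cV[R]_d -> R)
    (x : 'cV[R]_d) (S : 'M[R]_(l, d)) (B : 'M[R]_d) (s : 'cV[R]_l) : R :=
  f x + dot (S *m grad f x) s + 2^-1 * dot s (S *m B *m S^T *m s).

Definition reg_model (R : realType) (d l : nat) (f : 'cV[R]_d -> R)
    (x : 'cV[R]_d) (alpha : R) (S : 'M[R]_(l, d)) (B : 'M[R]_d)
    (s : 'cV[R]_l) : R :=
  model f x S B s + (2 * alpha)^-1 * norm2 (S^T *m s) ^+ 2.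

Definition sufficient_decrease (R : realType) (d l : nat)
    (f : 'cV[R]_d -> R) (theta : R) (x : 'cV[R]_d) (S : 'M[R]_(l, d))
    (B : 'M[R]_d) (s : 'cV[R]_l) : bool :=
  f x - f (x + S^T *m s) >= theta * (model f x S B 0 - model f x S B s).

Definition gamma2 (R : realType) (gamma1 : R) (c : nat) : R := gamma1 ^- c.

Record rsqr_step (R : realType) (d l : nat) (f : 'cV[R]_d -> R)
    (gamma1 : R) (c : nat) (theta alphamax Bmax kappaT : R)
    (S : 'M[R]_(l, d)) (B : 'M[R]_d) (s : 'cV[R]_l)
    (x : 'cV[R]_d) (alpha : R) (x' : 'cV[R]_d) (alpha' : R) : Prop := {
  step_psd : psd B;
  step_Bmax : opnorm2 B <= Bmax;
  step_stationary :
    norm2 (grad (reg_model f x alpha S B) s) <= kappaT * norm2 (S^T *m s);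
  step_decrease : reg_model f x alpha S B s <= reg_model f x alpha S B 0;
  step_x : x' = if sufficient_decrease f theta x S B s
                then x + S^T *m s else x;
  step_alpha : alpha' = if sufficient_decrease f theta x S B s
                        then Num.min alphamax (gamma2 gamma1 c * alpha)
                        else gamma1 * alpha }.

(* The iterates [x j] and step parameters [alpha j], [j <= k], are functions
   of the listed random matrices. *)
Definition history (R : realType) (disp : measure_display)
    (T : measurableType disp) (d l : nat) (S : nat -> T -> 'M[R]_(l, d))
    (B : nat -> T -> 'M[R]_d) (s : nat -> T -> 'cV[R]_l) (k : nat) :
    set (set T) :=
  <<s \bigcup_(j in [set j | (j < k)%N])
        (g_sigma_algebra_preimage (S j : T -> borel_mx R l d)
         `|` g_sigma_algebra_preimage (B j : T -> borel_mx R d d)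
         `|` g_sigma_algebra_preimage (s j : T -> borel_mx R l 1)) >>.

(* [B k] and [s k] may depend on [S k], on the past and on additional
   randomness. *)
Record rsqr_run (R : realType) (disp : measure_display)
    (T : measurableType disp) (P : probability T R) (d l : nat)
    (law : set 'M[R]_(l, d) -> \bar R) (f : 'cV[R]_d -> R)
    (gamma1 : R) (c : nat) (theta alphamax Bmax kappaT alpha0 : R)
    (x0 : 'cV[R]_d)
    (S : nat -> T -> 'M[R]_(l, d)) (B : nat -> T -> 'M[R]_d)
    (s : nat -> T -> 'cV[R]_l) (x : nat -> T -> 'cV[R]_d)
    (alpha : nat -> T -> R) (N : nat) : Prop := {
  run_measurable_S : forall k, (k < N)%N ->
    measurable_fun setT (S k : T -> borel_mx R l d);
  run_measurable_B : forall k, (k < N)%N ->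
    measurable_fun setT (B k : T -> borel_mx R d d);
  run_measurable_s : forall k, (k < N)%N ->
    measurable_fun setT (s k : T -> borel_mx R l 1);
  run_law : forall k, (k < N)%N -> forall A : set (borel_mx R l d),
    measurable A -> P (S k @^-1` A) = law A;
  run_indep : forall k, (k < N)%N -> forall E F : set T,
    history S B s k E ->
    g_sigma_algebra_preimage (S k : T -> borel_mx R l d) F ->
    P (E `&` F) = (P E * P F)%E;
  run_x0 : forall w, x 0%N w = x0;
  run_alpha0 : forall w, alpha 0%N w = alpha0;
  run_step : forall k, (k < N)%N -> forall w,
    rsqr_step f gamma1 c theta alphamax Bmax kappaT
      (S k w) (B k w) (s k w) (x k w) (alpha k w) (x k.+1 w) (alpha k.+1 w) }.

(* [+oo] when no iterate is [eps]-stationary. *)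
Definition N_eps (R : realType) (T : Type) (d : nat) (f : 'cV[R]_d -> R)
    (eps : R) (x : nat -> T -> 'cV[R]_d) (w : T) : \bar R :=
  ereal_inf [set (k%:R)%:E | k in [set k | norm2 (grad f (x k w)) <= eps]].

Definition alpha_low (R : realType) (theta L Bmax : R) : R :=
  (1 - theta) / (L + Bmax).

Definition tau_alpha (R : realType) (gamma1 : R) (c : nat)
    (theta L Bmax alpha0 : R) : int :=
  Num.ceil (ln (Num.min (alpha_low theta L Bmax / alpha0)
                        (gamma2 gamma1 c)^-1) / ln gamma1).

Definition h_decrease (R : realType) (d l : nat)
    (theta alphamax Bmax kappaT epsS eps alpha : R) : R :=
  theta * (1 - epsS) * eps ^+ 2
  / (2 * alphamax
     * (Num.sqrt (ceil_div d l)%:R * (Bmax + alpha^-1) + kappaT) ^+ 2).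

(* Main.v *)
(** The argument separates a deterministic count from a tail bound.  By the
    descent lemma every iteration with [alpha k <= alpha_low] succeeds, so the
    step parameter, which lives on the grid [alphamax * gamma1 ^+ e], never drops
    below [alpha0 * gamma1 ^ tau]; comparing the moves on the grid bounds the
    number of failures by [(tau + c N) / (1 + c)].  Call an iteration true when
    the drawn hashing matrix embeds the current gradient.  While the gradient
    exceeds [eps], a true success lowers [f] by at least [h_decrease], so the true
    iterations number at most the failures plus [(f x0 - fstar) / h_decrease],
    which for [N] as large as assumed is at most
    [(1 - deltaS) (1 - delta1) N].  Finally each iteration is true with
    conditional probability at least [1 - deltaS] given the past, since the past
    only selects which of the finitely many hashing matrices are good, and a
    Chernoff bound controls the lower tail of the number of true iterations. *)
Require Import Defs.
From mathcomp Require Import all_boot all_order all_algebra.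
From mathcomp Require Import all_classical all_reals all_analysis.
From mathcomp Require Import measurable_realfun.
From mathcomp Require Import ring lra zify.

Set Implicit Arguments.
Unset Strict Implicit.
Unset Printing Implicit Defensive.

Import Order.TTheory GRing.Theory Num.Theory.
Import numFieldNormedType.Exports.

Local Open Scope classical_set_scope.
Local Open Scope ring_scope.

(** * Euclidean norm and hashing matrices *)

Lemma dotE (R : realType) (n : nat) (u v : 'cV[R]_n) : dot u v = (u^T *m v) 0 0.
Proof. by rewrite mxE; apply: eq_bigr => i _; rewrite mxE. Qed.

Lemma dotC (R : realType) (n : nat) (u v : 'cV[R]_n) : dot u v = dot v u.
Proof. by apply: eq_bigr => i _; rewrite mulrC. Qed.

Lemma dotDr (R : realType) (n : nat) (u v w : 'cV[R]_n) :
  dot u (v + w) = dot u v + dot u w.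
Proof. by rewrite !dotE mulmxDr mxE. Qed.

Lemma dotZr (R : realType) (n : nat) (a : R) (u v : 'cV[R]_n) :
  dot u (a *: v) = a * dot u v.
Proof. by rewrite !dotE -scalemxAr mxE. Qed.

Lemma dotDl (R : realType) (n : nat) (u v w : 'cV[R]_n) :
  dot (u + v) w = dot u w + dot v w.
Proof. by rewrite ![dot _ w]dotC dotDr. Qed.

Lemma dotZl (R : realType) (n : nat) (a : R) (u v : 'cV[R]_n) :
  dot (a *: u) v = a * dot u v.
Proof. by rewrite ![dot _ v]dotC dotZr. Qed.

Lemma dot0r (R : realType) (n : nat) (u : 'cV[R]_n) : dot u 0 = 0.
Proof. by rewrite -(scale0r (0 : 'cV[R]_n)) dotZr mul0r. Qed.

Lemma dot_mulmxr (R : realType) (m n : nat) (A : 'M[R]_(m, n)) u v :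
  dot u (A *m v) = dot (A^T *m u) v.
Proof. by rewrite !dotE mulmxA trmx_mul trmxK. Qed.

Lemma dot_delta (R : realType) (n : nat) (u : 'cV[R]_n) i :
  dot u (delta_mx i 0) = u i 0.
Proof.
rewrite /dot (bigD1 i)//= big1 => [|j ji]; rewrite mxE ?eqxx ?mulr1 ?addr0//.
by rewrite (negbTE ji) mulr0.
Qed.

Lemma dot_ge0 (R : realType) (n : nat) (u : 'cV[R]_n) : 0 <= dot u u.
Proof. by apply: sumr_ge0 => i _; rewrite -expr2 sqr_ge0. Qed.

Lemma dot_eq0 (R : realType) (n : nat) (u : 'cV[R]_n) : dot u u = 0 -> u = 0.
Proof.
move=> /eqP; rewrite psumr_eq0 => [/allP u0|i _]; last by rewrite -expr2 sqr_ge0.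
apply/colP => i; rewrite mxE; apply/eqP.
by have := u0 i (mem_index_enum _); rewrite /= mulf_eq0 orbb.
Qed.

Lemma norm2_ge0 (R : realType) (n : nat) (u : 'cV[R]_n) : 0 <= norm2 u.
Proof. exact: sqrtr_ge0. Qed.

Lemma norm2_sqr (R : realType) (n : nat) (u : 'cV[R]_n) : norm2 u ^+ 2 = dot u u.
Proof. by rewrite sqr_sqrtr// dot_ge0. Qed.

Lemma norm2Z (R : realType) (n : nat) (a : R) (u : 'cV[R]_n) :
  norm2 (a *: u) = `|a| * norm2 u.
Proof.
by rewrite /norm2 dotZl dotZr mulrA -expr2 sqrtrM ?sqr_ge0// sqrtr_sqr.
Qed.

Lemma norm2_eq0 (R : realType) (n : nat) (u : 'cV[R]_n) : norm2 u = 0 -> u = 0.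
Proof. by move=> u0; apply: dot_eq0; rewrite -norm2_sqr u0 expr0n. Qed.

(** Cauchy-Schwarz: the squared norm of [dot v v *: u - dot u v *: v] is nonnegative and equals
    [dot v v] times the gap between the squared sides. *)
Lemma dot_norm2 (R : realType) (n : nat) (u v : 'cV[R]_n) :
  dot u v <= norm2 u * norm2 v.
Proof.
apply: (le_trans (ler_norm _)).
rewrite -ler_sqr ?nnegrE ?mulr_ge0 ?norm2_ge0// real_normK ?num_real//.
rewrite exprMn !norm2_sqr.
have [v0|vn0] := eqVneq (dot v v) 0.
  by rewrite (dot_eq0 v0) !dot0r mulr0 expr0n.
have vgt0 : 0 < dot v v by rewrite lt0r vn0 dot_ge0.
have := dot_ge0 (dot v v *: u + (- dot u v) *: v).
rewrite dotDl !dotDr !dotZl !dotZr [dot v u]dotC => h.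
rewrite -(ler_pM2l vgt0) -subr_ge0.
by apply: le_trans h _; rewrite le_eqVlt; apply/orP; left; apply/eqP; ring.
Qed.

Lemma ler_norm2D (R : realType) (n : nat) (u v : 'cV[R]_n) :
  norm2 (u + v) <= norm2 u + norm2 v.
Proof.
rewrite -ler_sqr ?nnegrE ?addr_ge0 ?norm2_ge0// norm2_sqr sqrrD !norm2_sqr.
have := dot_norm2 u v; rewrite dotDl !dotDr [dot v u]dotC; lra.
Qed.

(** Makes the [sup] in [opnorm2] a genuine upper bound rather than a default value. The bound chosen
    is the Frobenius norm, by Cauchy-Schwarz on each row. *)
Lemma norm2_mulmx_bounded (R : realType) (m n : nat) (A : 'M[R]_(m, n)) :
  exists M, forall u : 'cV[R]_n, norm2 u <= 1 -> norm2 (A *m u) <= M.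
Proof.
exists (Num.sqrt (\sum_i dot (row i A)^T (row i A)^T)) => u u1.
apply: ler_wsqrtr; apply: ler_sum => i _.
have -> : (A *m u) i 0 = dot (row i A)^T u.
  by rewrite mxE; apply: eq_bigr => j _; rewrite !mxE.
rewrite -expr2.
have h v : dot (row i A)^T v <= norm2 (row i A)^T * norm2 v by exact: dot_norm2.
have h1 : `|dot (row i A)^T u| <= norm2 (row i A)^T.
  have nA := norm2_ge0 (row i A)^T.
  have := h u; have := h (- u).
  rewrite -scaleN1r norm2Z dotZr normrN normr1 mul1r mulN1r ler_norml.
  have := ler_wpM2l nA u1; rewrite mulr1 => *; apply/andP; split; lra.
rewrite -norm2_sqr -(real_normK (num_real (dot _ _))).
by rewrite ler_sqr ?nnegrE ?norm2_ge0.
Qed.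

Lemma norm2_mulmx (R : realType) (m n : nat) (A : 'M[R]_(m, n)) (u : 'cV[R]_n) :
  norm2 (A *m u) <= opnorm2 A * norm2 u.
Proof.
have [u0|un0] := eqVneq (norm2 u) 0.
  by rewrite (norm2_eq0 u0) mulmx0 /norm2 !dot0r sqrtr0 mulr0.
have ugt0 : 0 < norm2 u by rewrite lt0r un0 norm2_ge0.
rewrite -ler_pdivrMr//.
have -> : norm2 (A *m u) / norm2 u = norm2 (A *m ((norm2 u)^-1 *: u)).
  by rewrite -scalemxAr norm2Z ger0_norm ?invr_ge0 ?norm2_ge0// mulrC.
apply: ub_le_sup.
  have [M AM] := norm2_mulmx_bounded A.
  by exists M => _ [v /= v1 <-]; exact: AM.
exists ((norm2 u)^-1 *: u) => //=.
by rewrite norm2Z ger0_norm ?invr_ge0 ?norm2_ge0// mulVf.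
Qed.

Lemma hash_mx_mulmx_tr (R : realType) (d l : nat) (w : hash_sample d l)
    (i j : 'I_l) :
  (hash_mx R w *m (hash_mx R w)^T) i j =
    #|[pred k | (w.1 k).1 == i]|%:R *+ (i == j).
Proof.
rewrite mxE; under eq_bigr do rewrite !mxE.
have [<-|ij] := eqVneq i j; last first.
  rewrite mulr0n big1// => k _; case: eqP => [->|]; last by rewrite mul0r.
  by rewrite (negbTE ij) mulr0.
rewrite mulr1n -sum1_card natr_sum [RHS]big_mkcond/=; apply: eq_bigr => k _.
by rewrite inE; case: eqP => _; rewrite ?mul0r// -expr2 sqrr_sign.
Qed.

(** Columns hashed to one row carry distinct copy labels, by injectivity, and only [ceil_div d l]
    labels exist. *)
Lemma card_hash_row (d l : nat) (w : hash_sample d l) (i : 'I_l) :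
  w \in hash_samples d l -> (#|[pred k | (w.1 k).1 == i]| <= ceil_div d l)%N.
Proof.
rewrite inE => /injectiveP winj.
rewrite -[leqRHS]card_ord -(card_in_imset (f := fun k => (w.1 k).2)).
  exact: max_card.
move=> a b; rewrite !inE => /eqP ai /eqP bi ab; apply: winj.
by rewrite [LHS]surjective_pairing [RHS]surjective_pairing ai bi ab.
Qed.

(* The rows of a hashing matrix are orthogonal, with squared norms the numbers
   of columns hashed to them. *)
Lemma norm2_hash_mx (R : realType) (d l : nat) (w : hash_sample d l)
    (v : 'cV[R]_d) : w \in hash_samples d l ->
  norm2 (hash_mx R w *m v) <= Num.sqrt (ceil_div d l)%:R * norm2 v.
Proof.
move=> ws; set H := hash_mx R w; set q : R := (ceil_div d l)%:R.
have tr_le y : dot (H^T *m y) (H^T *m y) <= q * dot y y.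
  rewrite -[H in X in X <= _]trmxK -dot_mulmxr trmxK mulmxA.
  rewrite /dot mulr_sumr; apply: ler_sum => i _.
  rewrite mxE (bigD1 i)//= big1 => [|j ji]; last first.
    by rewrite hash_mx_mulmx_tr eq_sym (negbTE ji) mul0r.
  rewrite hash_mx_mulmx_tr eqxx mulr1n addr0 mulrCA ler_wpM2r//.
    by rewrite -expr2 sqr_ge0.
  by rewrite ler_nat card_hash_row.
set y := H *m v.
have [y0|yn0] := eqVneq (norm2 y) 0.
  by rewrite y0 mulr_ge0 ?sqrtr_ge0 ?norm2_ge0.
have ygt0 : 0 < norm2 y by rewrite lt0r yn0 norm2_ge0.
(* Duality carries the bound from [H^T] to [H]: [norm2 y ^+ 2] equals [dot (H^T *m y) v], and one
   factor [norm2 y] cancels. *)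
rewrite -(ler_pM2l ygt0) -expr2 norm2_sqr {2}/y dot_mulmxr.
apply: (le_trans (dot_norm2 _ _)); rewrite mulrA ler_wpM2r ?norm2_ge0//.
rewrite [leRHS]mulrC -sqrtrM ?ler0n//; exact/ler_wsqrtr/tr_le.
Qed.

(** * Gradients and the descent lemma *)

Lemma derive_dot_grad (R : realType) (n : nat) (f : 'cV[R]_n -> R) x v :
  differentiable f x -> 'D_v f x = dot (grad f x) v.
Proof.
move=> df; rewrite deriveE// {1}(matrix_sum_delta v) linear_sum/=.
apply: eq_bigr => i _; rewrite big_ord1 linearZ/= mxE deriveE//.
by rewrite mulrC.
Qed.

Lemma is_derive_line (R : realType) (n : nat) (f : 'cV[R]_n -> R) x s (t : R) :
  differentiable f (x + t *: s) ->
  is_derive t 1 (fun t => f (x + t *: s)) (dot (grad f (x + t *: s)) s).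
Proof.
move=> df; rewrite -derive_dot_grad//.
have eqf : (fun h : R => h^-1 *: (((fun t => f (x + t *: s)) \o shift t) (h *: 1)
      - f (x + t *: s))) =
    (fun h => h^-1 *: ((f \o shift (x + t *: s)) (h *: s) - f (x + t *: s))).
  apply/funext => h /=; congr (_ *: (f _ - _)).
  by rewrite -[h%:A]/(h * 1) mulr1 scalerDl addrCA.
by split; [rewrite /derivable eqf; exact: diff_derivable | rewrite /derive eqf].
Qed.

(* [f (x + t s)] minus its quadratic upper model is nonincreasing in [t]. *)
Lemma descent_lemma (R : realType) (n : nat) (f : 'cV[R]_n -> R) (L : R) x s :
  (forall y, differentiable f y) ->
  (forall y z, norm2 (grad f y - grad f z) <= L * norm2 (y - z)) ->
  f (x + s) <= f x + dot (grad f x) s + L / 2 * norm2 s ^+ 2.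
Proof.
move=> df fL; set a := dot (grad f x) s; set b := L / 2 * norm2 s ^+ 2.
pose psi (t : R) := f (x + t *: s) - (t * a + t ^+ 2 * b).
pose dpsi (t : R) := dot (grad f (x + t *: s)) s - (a + 2 * t * b).
have dpsiP (t : R) : is_derive t 1 psi (dpsi t).
  have fP := is_derive_line (df (x + t *: s)).
  rewrite /psi; apply: is_derive_eq; rewrite /dpsi; congr (_ - _).
  by rewrite !scaler1 ![_ *: _]mulrC; ring.
have psic (t : R) : {for t, continuous psi}.
  by apply: differentiable_continuous; apply/derivable1_diffP; have [] := dpsiP t.
have [c] : exists2 c : R, c \in `]0, 1[ & psi 1 - psi 0 = dpsi c * (1 - 0).
  by apply: MVT => //; exact: continuous_subspaceT.
rewrite in_itv/= => /andP[/ltW c0 _].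
rewrite /psi scale1r scale0r addr0 expr1n expr0n/= !mul1r !mul0r addr0.
rewrite !subr0 mulr1 => psiE.
(* By the Lipschitz bound, moving from [x] to [x + c *: s] raises the slope [a] by at most
   [c * L * norm2 s ^+ 2], which is exactly [2 * c * b]. *)
suff : dpsi c <= 0 by lra.
rewrite /dpsi.
have := dot_norm2 (grad f (x + c *: s) - grad f x) s.
have -> : grad f (x + c *: s) - grad f x = grad f (x + c *: s) + -1 *: grad f x.
  by rewrite scaleN1r.
rewrite dotDl dotZl -/a scaleN1r => h1.
have h2 := fL (x + c *: s) x.
rewrite [x + _]addrC addrK norm2Z ger0_norm// in h2.
have := ler_wpM2r (norm2_ge0 s) h2; rewrite [c *: s + x]addrC.
rewrite /b; nra.
Qed.

(** For nonzero [h] the difference quotient is exactly [b + h * a], so the derivatives of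
    [reg_model] can be read off its expansion. *)
Lemma derive_quadratic (R : realType) (V : normedModType R) (q : V -> R) x v
    (a b : R) :
  (forall h : R, q (h *: v + x) = q x + h * b + h ^+ 2 * a) -> 'D_v q x = b.
Proof.
move=> qE; rewrite /derive; apply: cvg_lim => //.
apply: (@cvg_trans _ ((fun h : R => b + h * a) @ 0^')).
  apply: near_eq_cvg; near=> h.
  have h0 : h != 0 by near: h; exact: nbhs_dnbhs_neq.
  by rewrite /= qE -[RHS]/(_ * _); field.
have : (b + h * a) @[h --> (0 : R)^'] --> b + 0 * a.
  by apply: cvgD; [exact: cvg_cst|apply: cvgMl; exact: nbhs_dnbhs].
by rewrite mul0r addr0.
Unshelve. all: by end_near. Qed.

(** Along a coordinate direction, the symmetry of [B] merges the two cross terms of the quadratic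
    form, which cancels the factor one half. *)
Lemma grad_reg_model (R : realType) (d l : nat) (f : 'cV[R]_d -> R) x alpha
    (S : 'M[R]_(l, d)) B s : B^T = B ->
  grad (reg_model f x alpha S B) s =
    S *m (grad f x + B *m (S^T *m s) + alpha^-1 *: (S^T *m s)).
Proof.
move=> Bsym; apply/colP => i; rewrite mxE -[RHS]dot_delta dotC.
set e := delta_mx i 0; set M := S *m B *m S^T.
have MT : M^T = M by rewrite /M !trmx_mul trmxK Bsym mulmxA.
apply: (@derive_quadratic _ _ _ _ _
  (2^-1 * dot e (M *m e) + (2 * alpha)^-1 * dot (S^T *m e) (S^T *m e))) => h.
have -> : S *m (grad f x + B *m (S^T *m s) + alpha^-1 *: (S^T *m s)) =
    S *m grad f x + M *m s + alpha^-1 *: (S *m (S^T *m s)).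
  by rewrite !mulmxDr -scalemxAr !mulmxA.
rewrite /reg_model /model -/M !norm2_sqr !mulmxDr -!scalemxAr !dotDl !dotDr.
rewrite !dotZl !dotZr [dot s (M *m e)]dot_mulmxr MT [dot (M *m s) e]dotC.
rewrite [dot (S^T *m s) (S^T *m e)]dotC [dot e (S *m _)]dot_mulmxr.
rewrite [dot e (S *m _)]dot_mulmxr [dot (S *m grad f x) e]dotC.
rewrite [dot e (S *m _)]dot_mulmxr.
by rewrite invfM; move: alpha^-1 => ?; field.
Qed.

(** * One iteration *)

Lemma dot_hatE (R : realType) (d l : nat) (S : 'M[R]_(l, d)) (B : 'M[R]_d)
    (s : 'cV[R]_l) :
  dot s (S *m B *m S^T *m s) = dot (S^T *m s) (B *m (S^T *m s)).
Proof. by rewrite -!mulmxA dot_mulmxr. Qed.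

Lemma model0 (R : realType) (d l : nat) (f : 'cV[R]_d -> R) x
    (S : 'M[R]_(l, d)) B : model f x S B 0 = f x.
Proof. by rewrite /model mulmx0 !dot0r mulr0 !addr0. Qed.

Lemma model_decrease (R : realType) (d l : nat) (f : 'cV[R]_d -> R) x alpha
    (S : 'M[R]_(l, d)) B s :
  reg_model f x alpha S B s <= reg_model f x alpha S B 0 ->
  (2 * alpha)^-1 * norm2 (S^T *m s) ^+ 2 <= model f x S B 0 - model f x S B s.
Proof.
by rewrite /reg_model [S^T *m 0]mulmx0 [norm2 0 ^+ 2]norm2_sqr dot0r mulr0; lra.
Qed.

(** Let [D] be the model decrease and [u] the squared step length. The descent lemma, with the
    curvature term dropped by positivity of [B], gives an actual decrease of at least
    [D - L * u / 2]; since [u / 2 <= alpha * D], the loss is at most [(1 - theta) * D]. *)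
Lemma small_step_succeeds (R : realType) (d l : nat) (f : 'cV[R]_d -> R)
    (L theta : R) x alpha (S : 'M[R]_(l, d)) B s :
  (forall y, differentiable f y) ->
  (forall y z, norm2 (grad f y - grad f z) <= L * norm2 (y - z)) ->
  psd B -> 0 <= L -> 0 < alpha -> alpha * L <= 1 - theta ->
  reg_model f x alpha S B s <= reg_model f x alpha S B 0 ->
  sufficient_decrease f theta x S B s.
Proof.
move=> df fL [_ Bpos] L0 a0 aL /model_decrease.
rewrite /sufficient_decrease model0 /model dot_hatE.
rewrite [dot (S *m _) s]dotC dot_mulmxr [dot _ (grad f x)]dotC.
have := descent_lemma x (S^T *m s) df fL; have := Bpos (S^T *m s).
set u := norm2 _ ^+ 2; set g := dot (grad f x) _; set b := dot _ (B *m _).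
have u0 : 0 <= u by exact: sqr_ge0.
set D := f x - _ => b0 h1 h2.
have DE : D = - g - 2^-1 * b by rewrite /D; ring.
have h3 : u / 2 <= alpha * D.
  rewrite -(ler_pM2l a0) in h2; apply: le_trans h2.
  by rewrite le_eqVlt; apply/orP; left; apply/eqP; field; rewrite gt_eqF.
have h4 : L * (u / 2) <= L * (alpha * D) by rewrite ler_wpM2l.
have D0 : 0 <= D by rewrite -(pmulr_rge0 _ a0); lra.
have h5 : alpha * L * D <= (1 - theta) * D by rewrite ler_wpM2r.
nra.
Qed.

(** Approximate stationarity bounds [norm2 (S *m grad f x)] by [K * norm2 v], with [v] the step. As
    [S] embeds a gradient larger than [eps], the step cannot be short, and the model decrease is at
    least [norm2 v ^+ 2 / (2 * alphamax)]. *)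
Lemma true_step_decrease (R : realType) (d l : nat) (f : 'cV[R]_d -> R)
    (gamma1 theta alphamax Bmax kappaT epsS eps a alpha alpha' : R) (c : nat)
    (w : hash_sample d l) B s x x' :
  0 < theta -> 0 < Bmax -> 0 <= kappaT -> epsS < 1 -> 0 < eps ->
  0 < a -> a <= alpha -> alpha <= alphamax ->
  w \in hash_samples d l ->
  (1 - epsS) * norm2 (grad f x) ^+ 2 <= norm2 (hash_mx R w *m grad f x) ^+ 2 ->
  eps < norm2 (grad f x) ->
  rsqr_step f gamma1 c theta alphamax Bmax kappaT (hash_mx R w) B s
    x alpha x' alpha' ->
  h_decrease d l theta alphamax Bmax kappaT epsS eps a <=
    theta * (model f x (hash_mx R w) B 0 - model f x (hash_mx R w) B s).
Proof.
move=> th0 B0 k0 e1 eps0 a0 aalpha alm ws good gbig [[Bsym _] BB stat dec _ _].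
set S := hash_mx R w in good stat dec *; set v := S^T *m s in stat *.
have al0 : 0 < alpha by exact: lt_le_trans aalpha.
have am0 : 0 < alphamax by exact: lt_le_trans alm.
have := model_decrease dec; set D := model _ _ _ _ _ - _ => hD.
set q : R := Num.sqrt (ceil_div d l)%:R.
have q0 : 0 <= q by exact: sqrtr_ge0.
set K := q * (Bmax + a^-1) + kappaT.
have v0 := norm2_ge0 v.
have Sg : norm2 (S *m grad f x) <= K * norm2 v.
  have -> : S *m grad f x = grad (reg_model f x alpha S B) s +
      -1 *: (S *m (B *m v + alpha^-1 *: v)).
    by rewrite grad_reg_model// -/v scaleN1r -mulmxBr -[_ + _ + _ *: v]addrA addrK.
  apply: (le_trans (ler_norm2D _ _)); rewrite norm2Z normrN normr1 mul1r.
  have h1 : norm2 (S *m (B *m v + alpha^-1 *: v)) <=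
      q * norm2 (B *m v + alpha^-1 *: v) by exact: norm2_hash_mx.
  have h2 : norm2 (B *m v + alpha^-1 *: v) <= (Bmax + a^-1) * norm2 v.
    apply: (le_trans (ler_norm2D _ _)); rewrite mulrDl lerD//.
      by apply: (le_trans (norm2_mulmx _ _)); rewrite ler_wpM2r.
    by rewrite norm2Z ger0_norm ?invr_ge0 ?(ltW al0)// ler_wpM2r// lef_pV2//.
  have := ler_wpM2l q0 h2; rewrite /K; lra.
have K0 : 0 <= K by rewrite /K addr_ge0// mulr_ge0// addr_ge0 ?invr_ge0 ?(ltW B0) ?(ltW a0).
have h1 : (1 - epsS) * eps ^+ 2 <= (K * norm2 v) ^+ 2.
  apply: (@le_trans _ _ (norm2 (S *m grad f x) ^+ 2)).
    apply: le_trans good; rewrite ler_pM2l ?subr_gt0//.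
    by rewrite ler_sqr ?nnegrE ?norm2_ge0 ?(ltW eps0) ?(ltW gbig).
  by rewrite ler_sqr ?nnegrE ?norm2_ge0 ?mulr_ge0.
have K20 : 0 < K ^+ 2.
  rewrite lt0r sqr_ge0 andbT; apply/eqP => K2.
  have : 0 < (1 - epsS) * eps ^+ 2 by rewrite mulr_gt0 ?subr_gt0// exprn_gt0.
  by rewrite ltNge (le_trans h1)// exprMn K2 mul0r.
have h2 : (1 - epsS) * eps ^+ 2 / K ^+ 2 <= norm2 v ^+ 2.
  by rewrite ler_pdivrMr// [leRHS]mulrC -exprMn.
rewrite /h_decrease -/q -/K -!mulrA ler_pM2l// invfM.
apply: le_trans hD; rewrite -/v.
apply: (@le_trans _ _ ((2 * alphamax)^-1 * norm2 v ^+ 2)); last first.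
  rewrite ler_wpM2r ?sqr_ge0// lef_pV2 ?posrE ?mulr_gt0//.
  by rewrite ler_pM2l.
rewrite [leLHS](_ : _ = (2 * alphamax)^-1 * ((1 - epsS) * eps ^+ 2 / K ^+ 2)).
  by rewrite ler_wpM2l ?invr_ge0 ?mulr_ge0 ?(ltW am0).
by rewrite !invfM; ring.
Qed.

Lemma h_decrease_gt0 (R : realType) (d l : nat)
    (theta alphamax Bmax kappaT epsS eps a : R) :
  (0 < l)%N -> (0 < d)%N ->
  0 < theta -> 0 < alphamax -> 0 < Bmax -> 0 <= kappaT -> epsS < 1 ->
  0 < eps -> 0 < a ->
  0 < h_decrease d l theta alphamax Bmax kappaT epsS eps a.
Proof.
move=> l0 d0 th0 am0 B0 k0 e1 eps0 a0; rewrite /h_decrease divr_gt0//.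
  by rewrite !mulr_gt0 ?subr_gt0.
apply: mulr_gt0; first exact: mulr_gt0.
apply: exprn_gt0; apply: ltr_wpDr => //; apply: mulr_gt0.
  rewrite sqrtr_gt0 ltr0n /ceil_div divn_gt0//.
  by case: d d0 => // d _; rewrite addSn leq_addl.
by rewrite addr_gt0// invr_gt0.
Qed.

(** Tested on a coordinate vector and the origin, which are at distance one. *)
Lemma lipschitz_const_ge0 (R : realType) (m n : nat)
    (g : 'cV[R]_m -> 'cV[R]_n) (L : R) : (0 < m)%N ->
  (forall y z, norm2 (g y - g z) <= L * norm2 (y - z)) -> 0 <= L.
Proof.
move=> m0 /(_ (delta_mx (Ordinal m0) 0) 0); rewrite subr0.
rewrite {2}/norm2 dot_delta mxE !eqxx sqrtr1 mulr1; apply: le_trans.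
exact: norm2_ge0.
Qed.

(** * Trajectories *)

(** The term [1 / gamma2 <= 1] of the minimum makes the quotient of logarithms nonnegative, so its
    ceiling is a natural number; the other term gives the inequality. *)
Lemma tau_alphaP (R : realType) (gamma1 : R) (c : nat) (theta L Bmax alpha0 : R) :
  0 < gamma1 < 1 -> 0 < alpha0 -> 0 < alpha_low theta L Bmax ->
  exists2 t : nat, tau_alpha gamma1 c theta L Bmax alpha0 = t
    & alpha0 * gamma1 ^+ t <= alpha_low theta L Bmax.
Proof.
move=> /andP[g0 g1] a0 al0; rewrite /tau_alpha.
set m := Num.min _ _; set y := ln m / ln gamma1.
have lng : ln gamma1 < 0 by rewrite ln_lt0// g0.
have m0 : 0 < m.
  by rewrite lt_min divr_gt0//= /gamma2 invrK exprn_gt0.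
have y0 : 0 <= y.
  rewrite ler_ndivlMr// mul0r ln_le0// ge_min /gamma2 invrK; apply/orP; right.
  by rewrite exprn_ile1// ltW.
have := ceil_ge y; have : 0 <= Num.ceil y by rewrite ceil_ge0 (lt_le_trans _ y0).
case: (Num.ceil y) => // t _; exists t => //.
have : gamma1 ^+ t <= m.
  rewrite -ler_ln ?posrE ?exprn_gt0// lnXn// -mulr_natl.
  by rewrite -ler_ndivrMr.
rewrite le_min => /andP[+ _].
by rewrite ler_pdivlMr// mulrC.
Qed.

(** Truncation of natural subtraction encodes the cap: for [e < c] the uncapped product exceeds
    [alphamax]. *)
Lemma min_gamma2 (R : realType) (gamma1 alphamax : R) (c e : nat) :
  0 < gamma1 < 1 -> 0 < alphamax ->
  Num.min alphamax (gamma2 gamma1 c * (alphamax * gamma1 ^+ e)) =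
    alphamax * gamma1 ^+ (e - c).
Proof.
move=> /andP[g0 g1] a0; rewrite /gamma2 mulrCA.
have gc : gamma1 ^+ c != 0 by rewrite gt_eqF// exprn_gt0.
have [ce|/ltnW ec] := leqP c e.
  have -> : gamma1 ^- c * gamma1 ^+ e = gamma1 ^+ (e - c).
    by rewrite -{1}(subnK ce) exprD mulrC mulfK.
  by apply: min_r; rewrite ler_piMr ?exprn_ile1 ?ltW.
have -> : (e - c)%N = 0%N by apply/eqP; rewrite subn_eq0.
rewrite expr0 mulr1; apply: min_l.
rewrite ler_peMr ?(ltW a0)// mulrC ler_pdivlMr ?exprn_gt0// mul1r.
by rewrite ler_wiXn2l ?ltW.
Qed.

(* The step parameter is [alphamax * gamma1 ^+ e]: a failure raises [e] by one
   and only happens above [alpha_low], so [e <= p + t] throughout, while a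
   success lowers [e] by at most [c].  [U], [V], [W] count the failures, the
   successes and the true successes among the first [n] iterations. *)
Lemma trajectory_counts (R : realType) (d l : nat) (f : 'cV[R]_d -> R)
    (L gamma1 theta alphamax Bmax kappaT epsS eps a : R) (c p t : nat)
    (S : nat -> 'M[R]_(l, d)) (B : nat -> 'M[R]_d) (s : nat -> 'cV[R]_l)
    (x : nat -> 'cV[R]_d) (alpha : nat -> R) (tr : nat -> bool) (N : nat) :
  (0 < d)%N ->
  (forall y, differentiable f y) ->
  (forall y z, norm2 (grad f y - grad f z) <= L * norm2 (y - z)) ->
  0 < gamma1 < 1 -> 0 < theta < 1 -> 0 < alphamax -> 0 < Bmax -> 0 <= kappaT ->
  epsS < 1 -> 0 < eps ->
  alphamax * gamma1 ^+ (p + t) <= alpha_low theta L Bmax ->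
  0 < a -> a <= alphamax * gamma1 ^+ (p + t) ->
  alpha 0%N = alphamax * gamma1 ^+ p ->
  (forall k, (k < N)%N -> rsqr_step f gamma1 c theta alphamax Bmax kappaT
    (S k) (B k) (s k) (x k) (alpha k) (x k.+1) (alpha k.+1)) ->
  (forall k, (k < N)%N -> tr k -> exists w, [/\ w \in hash_samples d l,
    S k = hash_mx R w & (1 - epsS) * norm2 (grad f (x k)) ^+ 2
      <= norm2 (S k *m grad f (x k)) ^+ 2]) ->
  (forall k, (k < N)%N -> eps < norm2 (grad f (x k))) ->
  exists U V W : nat, [/\ (U <= t + c * V)%N, (U + V = N)%N,
    (\sum_(k < N) tr k <= U + W)%N &
    W%:R * h_decrease d l theta alphamax Bmax kappaT epsS eps a
      <= f (x 0%N) - f (x N)].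
Proof.
move=> d0 df fL g01 /andP[th0 th1] am0 B0 k0 e1 eps0 alow a0 ale al0 step trP big.
have /andP[g0 g1] := g01.
have L0 := lipschitz_const_ge0 d0 fL.
set h := h_decrease _ _ _ _ _ _ _ _ _.
(* The induction carries the exponent [e] of the step parameter; at the end [e <= p + t] turns
   [p + U <= e + c * V] into the bound on [U]. *)
suff H n : (n <= N)%N -> exists e U V W : nat,
    [/\ alpha n = alphamax * gamma1 ^+ e, (e <= p + t)%N,
        (p + U <= e + c * V)%N, (U + V = n)%N &
        (\sum_(k < n) tr k <= U + W)%N /\ W%:R * h <= f (x 0%N) - f (x n)].
  have [e [U [V [W [_ h1 h2 h3 [h4 h5]]]]]] := H N (leqnn N).
  by exists U, V, W; split => //; clear -h1 h2; lia.
elim: n => [_|n IH nN].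
  exists p, 0%N, 0%N, 0%N; split; rewrite ?addn0 ?leq_addr//.
  by rewrite big_ord0 mul0r subrr.
have [e [U [V [W [ale_n h1 h2 h3 [h4 h5]]]]]] := IH (ltnW nN).
have stepn := step n nN.
have al_gt0 : 0 < alpha n by rewrite ale_n mulr_gt0// exprn_gt0.
have [Bpsd _ _ dec xE alE] := stepn.
have D0 : 0 <= model f (x n) (S n) (B n) 0 - model f (x n) (S n) (B n) (s n).
  apply: le_trans (model_decrease dec) => //.
  by rewrite mulr_ge0 ?sqr_ge0// invr_ge0 mulr_ge0 ?(ltW al_gt0).
rewrite big_ord_recr/=.
case: ifP xE alE => [suc|/negbT fail] xE alE; last first.
  exists e.+1, U.+1, V, W; rewrite xE.
  split; [by rewrite alE ale_n exprS mulrCA| |clear -h2; lia|clear -h3; lia|split=> //].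
    (* With [e >= p + t] the step parameter would be at most [alpha_low] and the iteration would
       succeed; so a failure leaves room for [e.+1]. *)
    rewrite ltnNge; apply: contraNN fail => ge.
    apply: (small_step_succeeds df fL Bpsd L0 al_gt0 _ dec).
    have LB : 0 < L + Bmax by exact: ltr_wpDl.
    have : alpha n * (L + Bmax) <= 1 - theta.
      rewrite -ler_pdivlMr//; apply: le_trans alow.
      rewrite ale_n ler_pM2l// ler_wiXn2l ?ltW//.
    have : 0 <= alpha n * Bmax by rewrite mulr_ge0 ?ltW.
    lra.
  by rewrite (leq_trans (leq_add h4 (leq_b1 _)))// addn1 addSn.
(* A true failure was charged to [U], so [W] grows only on a true success; on any other success [f]
   does not increase, by [D0]. *)
exists (e - c)%N, U, V.+1, (W + tr n)%N.
split; [by rewrite alE ale_n min_gamma2|clear -h1; lia|clear -h2; lia|clear -h3; lia|split].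
  by rewrite addnA leq_add2r.
have fdec : theta * (model f (x n) (S n) (B n) 0 - model f (x n) (S n) (B n) (s n))
    <= f (x n) - f (x n.+1) by rewrite xE.
have := mulr_ge0 (ltW th0) D0; move: fdec.
case trn : (tr n); last by rewrite addn0; lra.
have [w [ws Sw good]] := trP n nN trn.
move=> fdec _; rewrite natrD mulrDl mul1r.
suff : h <= f (x n) - f (x n.+1) by lra.
apply: le_trans fdec.
rewrite Sw in good stepn *.
apply: (true_step_decrease _ _ _ _ _ _ _ _ ws good (big n nN) stepn) => //.
- by apply: (le_trans ale); rewrite ale_n ler_pM2l// ler_wiXn2l ?ltW.
- by rewrite ale_n ler_piMr ?exprn_ile1 ?ltW.
Qed.

(** * Scalar inequalities for the tail bound and for the count *)

(** Mean value theorem for the gap between the sides, up to a constant: its derivative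
    [t - 1 + expR (- t)] is nonnegative by [expR_ge1Dx]. *)
Lemma expRN_le_quadratic (R : realType) (x : R) : 0 <= x ->
  expR (- x) <= 1 - x + x ^+ 2 / 2.
Proof.
rewrite le_eqVlt => /orP[/eqP<-|x0].
  by rewrite oppr0 expR0 expr0n/= mul0r !addr0.
pose g (t : R) := t ^+ 2 * 2^-1 - t - expR (- t).
pose dg (t : R) := t - 1 + expR (- t).
have gP (t : R) : is_derive t 1 g (dg t).
  rewrite /g; apply: is_derive_eq; rewrite /dg !scaler1 scaler0.
  by rewrite ![_ *: _]mulrC; field.
have gc (t : R) : {for t, continuous g}.
  by apply: differentiable_continuous; apply/derivable1_diffP; have [] := gP t.
have [c] : exists2 c : R, c \in `]0, x[ & g x - g 0 = dg c * (x - 0).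
  by apply: MVT => //; exact: continuous_subspaceT.
rewrite in_itv/= => /andP[c0 _].
rewrite /g oppr0 expR0 expr0n/= mul0r !addr0.
have : 0 <= dg c * x.
  by rewrite mulr_ge0 ?(ltW x0)// /dg; have := expR_ge1Dx (- c); lra.
lra.
Qed.

(** The exponential tilt is taken equal to the relative deviation [x]. The base of the power is at
    most [expR (- (q * (x - x ^+ 2 / 2)))], and the exponents add up to [- q * x ^+ 2 / 2] per
    iteration. *)
Lemma chernoff_exponent (R : realType) (q x : R) (n : nat) :
  0 <= q <= 1 -> 0 <= x ->
  expR (x * (q * (1 - x) * n%:R)) * (1 - q * (1 - expR (- x))) ^+ n <=
    expR (- (x ^+ 2 / 2 * q * n%:R)).
Proof.
move=> /andP[q0 q1] x0.
have ex0 := expR_gt0 (- x).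
have ex1 : expR (- x) <= 1 by rewrite -expR0 ler_expR oppr_le0.
have h1 : 0 <= 1 - q * (1 - expR (- x)) by nra.
have h2 : 1 - q * (1 - expR (- x)) <= expR (- (q * (x - x ^+ 2 / 2))).
  apply: le_trans (expR_ge1Dx _); rewrite lerD2l lerN2.
  by rewrite ler_wpM2l//; have := expRN_le_quadratic x0; lra.
apply: le_trans (_ : _ <= expR (x * (q * (1 - x) * n%:R)) *
    expR (- (q * (x - x ^+ 2 / 2))) ^+ n) _.
  by rewrite ler_pM2l ?expR_gt0// lerXn2r// nnegrE// ltW// expR_gt0.
rewrite -expRM_natl -expRD ler_expR mulrC.
by rewrite le_eqVlt; apply/orP; left; apply/eqP; field.
Qed.

(** Failures number at most [(t + c * N) / (1 + c)], and the assumed size of [N] bounds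
    [t / (1 + c) + D / h] by [k * N], with [k] the inverted bracket. *)
Lemma true_count_bound (R : realType) (c t N n U V W : nat) (D h r : R) :
  (U <= t + c * V)%N -> (U + V = N)%N -> (n <= U + W)%N ->
  0 < h -> W%:R * h <= D ->
  0 < r - 1 + c%:R / (c%:R + 1) ^+ 2 ->
  (r - 1 + c%:R / (c%:R + 1) ^+ 2)^-1 * (D / h + t%:R / (1 + c%:R)) <= N%:R ->
  n%:R <= r * N%:R.
Proof.
move=> hU hN hn h0 hW k0; set k := r - 1 + _ in k0 *.
rewrite mulrC ler_pdivrMr// => hk.
have c1 : 0 < c%:R + 1 :> R by rewrite ltr_wpDl.
have {}hW : W%:R <= D / h by rewrite ler_pdivlMr.
have {}hn : n%:R <= U%:R + W%:R :> R by rewrite -natrD ler_nat.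
have {}hU : U%:R <= t%:R / (1 + c%:R) + c%:R / (c%:R + 1) * N%:R :> R.
  have : U%:R * (c%:R + 1) <= t%:R + c%:R * N%:R :> R.
    rewrite -hN natrD; have : U%:R <= t%:R + c%:R * V%:R :> R.
      by rewrite -natrM -natrD ler_nat.
    by lra.
  rewrite -ler_pdivlMr// mulrDl [1 + _]addrC mulrAC; lra.
(* This is [c * (c + 2) <= (c + 1) ^+ 2]: the margin [c / (c + 1) ^+ 2] fits in the fraction left
   after the failures. *)
have : (c%:R / (c%:R + 1) + c%:R / (c%:R + 1) ^+ 2) * N%:R <= 1 * N%:R :> R.
  rewrite ler_wpM2r//.
  have -> : c%:R / (c%:R + 1) + c%:R / (c%:R + 1) ^+ 2 =
      (c%:R * (c%:R + 1) + c%:R) / (c%:R + 1) ^+ 2 :> R.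
    by field; rewrite gt_eqF.
  by rewrite ler_pdivrMr ?exprn_gt0//; lra.
rewrite /k in hk; lra.
Qed.

(** * Borel measurability of the iterates *)

Lemma continuous_measurable_borel_mx (R : realType) (m n : nat)
    (g : 'M[R]_(m, n) -> R) :
  continuous g -> measurable_fun setT (g : borel_mx R m n -> R).
Proof.
move=> gc; apply: (measurability _ (RGenOpens.measurableE R)) => _ [_ [a [b ->]] <-].
by rewrite setTI; apply: sub_sigma_algebra; apply: open_comp => // ? _; exact: gc.
Qed.

Lemma measurable_mx_entry (R : realType) (disp : measure_display)
    (T : measurableType disp) (m n : nat) (u : T -> borel_mx R m n) i j :
  measurable_fun setT u ->
  measurable_fun setT (fun w => (u w : 'M[R]_(m, n)) i j).
Proof.
move=> mu; have := @coord_continuous R m n i j.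
by move=> /continuous_measurable_borel_mx /measurableT_comp; exact.
Qed.

(** A countable base of the topology: rational centres and radii [1 / (k + 1)]. *)
Definition rat_box (R : realType) (m n : nat) (Ak : 'M[rat]_(m, n) * nat) :
    set 'M[R]_(m, n) :=
  [set M | forall i j, `|M i j - ratr (Ak.1 i j)| < Ak.2.+1%:R^-1].

Lemma open_rat_box (R : realType) (m n : nat) (U : set 'M[R]_(m, n)) :
  open U -> U = \bigcup_(Ak in [set Ak | @rat_box R m n Ak `<=` U]) @rat_box R m n Ak.
Proof.
move=> Uo; apply/seteqP; split=> [M UM|M [Ak /= AkU]]; last exact: AkU.
have /nbhs_ballP[e /= e0 MeU] : nbhs M U by exact: open_nbhs_nbhs.
have e20 : 0 < e / 2 by rewrite divr_gt0.
have [k _ /(_ k (leqnn k)) /= ke] := near_infty_natSinv_lt (PosNum e20).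
have [r [rE r0 re]] : exists r : R, [/\ k.+1%:R^-1 = r, 0 < r & r < e / 2].
  by exists k.+1%:R^-1; split; rewrite ?invr_gt0.
have AP i j : exists a : rat, `|M i j - ratr a| < r.
  have [|a] := @rat_in_itvoo R (M i j - r) (M i j + r); first by lra.
  rewrite in_itv/= => /andP[a1 a2]; exists a.
  by rewrite ltr_norml; apply/andP; split; lra.
pose A := \matrix_(i, j) xchoose (AP i j).
have MA : @rat_box R m n (A, k) M.
  by move=> i j; rewrite mxE rE; exact: (xchooseP (AP i j)).
exists (A, k) => //= N NA; apply: MeU; split=> // i j.
have := MA i j; have := NA i j; rewrite /= rE -ball_normE/=.
rewrite (distrC (N i j)) => h1 h2.
have -> : M i j - N i j = (M i j - ratr (A i j)) + (ratr (A i j) - N i j) by ring.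
apply: le_lt_trans (ler_normD _ _) _; lra.
Qed.

(** An open set is a countable union of rational boxes, and the preimage of a box is a finite
    intersection of conditions on single entries. *)
Lemma measurable_mx (R : realType) (disp : measure_display)
    (T : measurableType disp) (m n : nat) (u : T -> 'M[R]_(m, n)) :
  (forall i j, measurable_fun setT (fun w => u w i j)) ->
  measurable_fun setT (u : T -> borel_mx R m n).
Proof.
move=> mu; apply: (@measurability _ _ T (borel_mx R m n) setT u open) => //.
move=> _ [U Uo <-]; rewrite (open_rat_box Uo) preimage_bigcup setTI bigcup_mkcond.
apply: countable_bigcupT_measurable => [|Ak]; first exact: countableP.
case: ifP => // _.
rewrite [X in measurable X](_ : _ = \bigcap_(ij in [set: 'I_m * 'I_n])
    ((fun w => u w ij.1 ij.2 - ratr (Ak.1 ij.1 ij.2)) @^-1`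
      [set y | `|y| < Ak.2.+1%:R^-1])); last first.
  by apply/seteqP; split=> [w /= h [i j] _|w /= h i j]; [exact: h|exact: (h (i, j))].
apply: fin_bigcap_measurable => // [[i j] _] /=.
set r := _^-1; pose dist w := `|u w i j - ratr (Ak.1 i j)|.
have mdist : measurable_fun setT dist.
  apply: measurableT_comp => //; apply: measurable_funB => //; exact: mu.
rewrite [X in measurable X](_ : _ = setT `&` dist @^-1` `]-oo, r[%classic).
  exact: mdist.
by rewrite setTI; apply/seteqP; split=> w /=; rewrite in_itv.
Qed.

Lemma measurable_continuous_mx (R : realType) (disp : measure_display)
    (T : measurableType disp) (m n : nat) (g : 'M[R]_(m, n) -> R)
    (u : T -> 'M[R]_(m, n)) :
  continuous g -> measurable_fun setT (u : T -> borel_mx R m n) ->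
  measurable_fun setT (fun w => g (u w)).
Proof.
by move=> /continuous_measurable_borel_mx /measurableT_comp; exact.
Qed.

Lemma measurable_mulmx (R : realType) (disp : measure_display)
    (T : measurableType disp) (m n q : nat) (u : T -> 'M[R]_(m, n))
    (v : T -> 'M[R]_(n, q)) :
  measurable_fun setT (u : T -> borel_mx R m n) ->
  measurable_fun setT (v : T -> borel_mx R n q) ->
  measurable_fun setT ((fun w => u w *m v w) : T -> borel_mx R m q).
Proof.
move=> mu mv; apply: measurable_mx => i j; under eq_fun do rewrite mxE.
apply: measurable_sum => k; apply: measurable_funM; exact: measurable_mx_entry.
Qed.

Lemma measurable_trmx (R : realType) (disp : measure_display)
    (T : measurableType disp) (m n : nat) (u : T -> 'M[R]_(m, n)) :
  measurable_fun setT (u : T -> borel_mx R m n) ->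
  measurable_fun setT ((fun w => (u w)^T) : T -> borel_mx R n m).
Proof.
move=> mu; apply: measurable_mx => i j; under eq_fun do rewrite mxE.
exact: measurable_mx_entry.
Qed.

Lemma measurable_addmx (R : realType) (disp : measure_display)
    (T : measurableType disp) (m n : nat) (u v : T -> 'M[R]_(m, n)) :
  measurable_fun setT (u : T -> borel_mx R m n) ->
  measurable_fun setT (v : T -> borel_mx R m n) ->
  measurable_fun setT ((fun w => u w + v w) : T -> borel_mx R m n).
Proof.
move=> mu mv; apply: measurable_mx => i j; under eq_fun do rewrite mxE.
apply: measurable_funD; exact: measurable_mx_entry.
Qed.

Lemma measurable_dot (R : realType) (disp : measure_display)
    (T : measurableType disp) (n : nat) (u v : T -> 'cV[R]_n) :
  measurable_fun setT (u : T -> borel_mx R n 1) ->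
  measurable_fun setT (v : T -> borel_mx R n 1) ->
  measurable_fun setT (fun w => dot (u w) (v w)).
Proof.
move=> mu mv; apply: measurable_sum => i.
by apply: measurable_funM; exact: measurable_mx_entry.
Qed.

Lemma measurable_norm2 (R : realType) (disp : measure_display)
    (T : measurableType disp) (n : nat) (u : T -> 'cV[R]_n) :
  measurable_fun setT (u : T -> borel_mx R n 1) ->
  measurable_fun setT (fun w => norm2 (u w)).
Proof.
move=> mu; apply: measurableT_comp (measurable_dot mu mu).
apply: continuous_measurable_fun; exact: sqrt_continuous.
Qed.

Lemma measurable_continuous_comp_mx (R : realType) (disp : measure_display)
    (T : measurableType disp) (m n m' n' : nat) (g : 'M[R]_(m, n) -> 'M[R]_(m', n'))
    (u : T -> 'M[R]_(m, n)) :
  continuous g -> measurable_fun setT (u : T -> borel_mx R m n) ->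
  measurable_fun setT ((fun w => g (u w)) : T -> borel_mx R m' n').
Proof.
move=> gc mu; apply: measurable_mx => i j.
apply: (@measurable_continuous_mx _ _ _ _ _ (fun M => g M i j)) mu => M.
apply: (@continuous_comp _ _ _ g (fun N : 'M[R]_(m', n') => N i j)).
  exact: gc.
exact: coord_continuous.
Qed.

Lemma measurable_model (R : realType) (disp : measure_display)
    (T : measurableType disp) (d l : nat) (f : 'cV[R]_d -> R)
    (x : T -> 'cV[R]_d) (S : T -> 'M[R]_(l, d)) (B : T -> 'M[R]_d)
    (s : T -> 'cV[R]_l) :
  continuous f -> continuous (grad f) ->
  measurable_fun setT (x : T -> borel_mx R d 1) ->
  measurable_fun setT (S : T -> borel_mx R l d) ->
  measurable_fun setT (B : T -> borel_mx R d d) ->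
  measurable_fun setT (s : T -> borel_mx R l 1) ->
  measurable_fun setT (fun w => model f (x w) (S w) (B w) (s w)).
Proof.
move=> fc gc mx mS mB ms; apply: measurable_funD.
  apply: measurable_funD; first exact: (measurable_continuous_mx fc mx).
  apply: measurable_dot => //; apply: measurable_mulmx => //.
  exact: measurable_continuous_comp_mx.
apply: measurable_funM => //; apply: measurable_dot => //.
apply: measurable_mulmx => //; apply: measurable_mulmx; last exact: measurable_trmx.
exact: measurable_mulmx.
Qed.

(** Each iterate is a measurable case distinction on earlier data. The structure on [T] stays
    general so that it can be the history, which makes the iterates adapted. *)
Lemma measurable_iterates (R : realType) (disp : measure_display)
    (T : measurableType disp) (d l : nat) (f : 'cV[R]_d -> R) (theta : R)
    (S : nat -> T -> 'M[R]_(l, d)) (B : nat -> T -> 'M[R]_d)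
    (s : nat -> T -> 'cV[R]_l) (x : nat -> T -> 'cV[R]_d) (x0 : 'cV[R]_d) (n : nat) :
  continuous f -> continuous (grad f) ->
  (forall k, (k < n)%N -> measurable_fun setT (S k : T -> borel_mx R l d)) ->
  (forall k, (k < n)%N -> measurable_fun setT (B k : T -> borel_mx R d d)) ->
  (forall k, (k < n)%N -> measurable_fun setT (s k : T -> borel_mx R l 1)) ->
  (forall w, x 0%N w = x0) ->
  (forall k, (k < n)%N -> forall w, x k.+1 w =
    if sufficient_decrease f theta (x k w) (S k w) (B k w) (s k w)
    then x k w + (S k w)^T *m s k w else x k w) ->
  measurable_fun setT (x n : T -> borel_mx R d 1).
Proof.
move=> fc gc; elim: n => [_ _ _ xE _|n IH mS mB ms xE stepE].
  by rewrite (_ : x 0%N = cst x0); [exact: measurable_cst|exact/funext].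
have mxn : measurable_fun setT (x n : T -> borel_mx R d 1).
  by apply: IH => // k kn; [apply: mS|apply: mB|apply: ms|apply: stepE]; exact: ltnW.
have [[mSn mBn] msn] := (mS n (ltnSn n), mB n (ltnSn n), ms n (ltnSn n)).
have mx' : measurable_fun setT
    ((fun w => x n w + (S n w)^T *m s n w) : T -> borel_mx R d 1).
  apply: measurable_addmx => //; apply: measurable_mulmx => //.
 exact: measurable_trmx.
have -> : x n.+1 = (fun w =>
    if sufficient_decrease f theta (x n w) (S n w) (B n w) (s n w)
    then x n w + (S n w)^T *m s n w else x n w).
  by apply/funext => w; exact: stepE.
apply: measurable_fun_ifT => //.
apply: measurable_fun_ler.
  apply: measurable_funM => //.
  by apply: measurable_funB; apply: measurable_model.
by apply: measurable_funB; exact: measurable_continuous_mx.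
Qed.

(** * Lower tail of the number of true iterations *)

Lemma fine_probabilityDI (R : realType) (disp : measure_display)
    (T : measurableType disp) (P : probability T R) (A B : set T) :
  measurable A -> measurable B ->
  fine (P A) = fine (P (A `\` B)) + fine (P (A `&` B)).
Proof.
move=> mA mB; rewrite (measureDI P mA mB) fineD// fin_num_measure//.
  exact: measurableD.
exact: measurableI.
Qed.

Lemma fine_probability_le (R : realType) (disp : measure_display)
    (T : measurableType disp) (P : probability T R) (A B : set T) :
  measurable A -> measurable B -> A `<=` B -> fine (P A) <= fine (P B).
Proof.
by move=> mA mB AB; rewrite fine_le ?fin_num_measure// le_measure// inE.
Qed.

(** Total probability over the values of [c], peeling off one fibre at a time along the enumeration
    of [I]. *)
Lemma fine_probability_fibers (R : realType) (disp : measure_display)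
    (T : measurableType disp) (P : probability T R) (I : finType) (c : T -> I)
    (A : set T) :
  measurable A -> (forall i, measurable (c @^-1` [set i])) ->
  fine (P A) = \sum_i fine (P (A `&` c @^-1` [set i])).
Proof.
move=> mA mc; have mseq (r : seq I) : measurable (A `&` [set w | c w \in r]).
  apply: measurableI => //; elim: r => [|i r IH].
    by rewrite (_ : [set _ | _] = set0)//; apply/seteqP; split.
  rewrite (_ : [set _ | _] = c @^-1` [set i] `|` [set w | c w \in r]).
    exact: measurableU.
  apply/seteqP; split=> w /=; rewrite in_cons; first by case/orP => [/eqP|]; [left|right].
  by case=> [->|->]; rewrite ?eqxx ?orbT.
have AE : A = A `&` [set w | c w \in index_enum I].
  by apply/seteqP; split=> [w Aw|w []//]; split; rewrite //= mem_index_enum.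
rewrite [in LHS]AE; have := index_enum_uniq I;
elim: (index_enum I) => [_|i r IH /= /andP[ir ur]].
  rewrite big_nil [X in P X](_ : _ = set0) ?measure0//.
  by apply/seteqP; split=> w // [].
rewrite big_cons (fine_probabilityDI P (mseq (i :: r)) (mc i)) addrC.
congr (fine (P _) + _).
  apply/seteqP; split=> w /= []; first by move=> [].
  by move=> Aw cw; split=> //; split=> //; rewrite cw mem_head.
rewrite -IH//; congr (fine (P _)); apply/seteqP; split=> w /= [].
  by move=> [Aw]; rewrite in_cons => /orP[/eqP->|cr] /=.
move=> Aw cr; split; first by rewrite in_cons cr orbT.
by move=> ci; rewrite ci (negbTE ir) in cr.
Qed.

Definition true_count (T : Type) (Tr : nat -> set T) (n : nat) (w : T) : nat :=
  (\sum_(k < n) `[< Tr k w >])%N.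

Lemma true_count_le (T : Type) (Tr : nat -> set T) (n : nat) (w : T) :
  (true_count Tr n w <= n)%N.
Proof.
rewrite -[leqRHS]card_ord -sum1_card; apply: leq_sum => k _; exact: leq_b1.
Qed.

Lemma true_countS (T : Type) (Tr : nat -> set T) (n m : nat) :
  true_count Tr n.+1 @^-1` [set m] =
    (true_count Tr n @^-1` [set m] `\` Tr n) `|`
    (if m is m'.+1 then true_count Tr n @^-1` [set m'] `&` Tr n else set0).
Proof.
apply/seteqP; split=> w /=; rewrite /true_count big_ord_recr/= -/(true_count Tr n w).
  case: asboolP => Trw; last by rewrite addn0; left.
  by rewrite addn1 => <-; right.
case=> [[<- nTrw]|]; first by rewrite asboolF// addn0.
by case: m => // m [<- Trw]; rewrite asboolT// addn1.
Qed.

Lemma measurable_true_count (disp : measure_display) (T : measurableType disp)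
    (Tr : nat -> set T) (n m : nat) :
  (forall k, (k < n)%N -> measurable (Tr k)) ->
  measurable (true_count Tr n @^-1` [set m]).
Proof.
elim: n m => [m _|n IH m mTr].
  have -> : true_count Tr 0 = cst 0%N.
    by apply/funext => w; rewrite /true_count big_ord0.
  by rewrite preimage_cst; case: ifP.
have mTr' k : (k < n)%N -> measurable (Tr k) by move=> kn; apply/mTr/ltnW.
rewrite true_countS; apply: measurableU.
  by apply: measurableD; [exact: IH|exact: mTr].
by case: m => // m; apply: measurableI; [exact: IH|exact: mTr].
Qed.

(** The sum is the expectation of [y] to the power of the count. One more iteration replaces the
    mass [a m] of a level by [a m - (1 - y) * b m], where [b m] is its true part, and
    [b m >= q * a m]. *)
Lemma generating_function_decay (R : realType) (disp : measure_display)
    (T : measurableType disp) (P : probability T R) (Tr : nat -> set T)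
    (N : nat) (q y : R) :
  0 <= y <= 1 ->
  (forall k, (k < N)%N -> measurable (Tr k)) ->
  (forall k m, (k < N)%N -> let A := true_count Tr k @^-1` [set m] in
    q * fine (P A) <= fine (P (A `&` Tr k))) ->
  0 <= 1 - q * (1 - y) ->
  \sum_(m < N.+1) y ^+ m * fine (P (true_count Tr N @^-1` [set (m : nat)])) <=
    (1 - q * (1 - y)) ^+ N.
Proof.
move=> /andP[y0 y1] + + r0; elim: N => [|n IH] mTr cond.
  rewrite big_ord_recl big_ord0 addr0 !expr0 mul1r.
  by rewrite -[leRHS]/(fine 1%:E) fine_le ?fin_num_measure// ?probability_le1//;
    exact: measurable_true_count.
have mTr' k : (k < n)%N -> measurable (Tr k) by move=> kn; apply/mTr/ltnW.
have {}IH := IH mTr' (fun k m kn => cond k m (ltnW kn)).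
pose C m := true_count Tr n @^-1` [set m].
have mC m : measurable (C m) by exact: measurable_true_count.
have mTn := mTr n (ltnSn n).
pose a m := fine (P (C m)); pose b m := fine (P (C m `&` Tr n)).
have stepE m : fine (P (true_count Tr n.+1 @^-1` [set m])) =
    (a m - b m) + (if m is m'.+1 then b m' else 0).
  rewrite true_countS -/(C m).
  have -> : a m - b m = fine (P (C m `\` Tr n)).
    by rewrite /a (fine_probabilityDI P (mC m) mTn) addrK.
  have mD := measurableD (mC m) mTn.
  case: m mD => [|m] mD; first by rewrite setU0 addr0.
  have mI : measurable (C m `&` Tr n) by exact: measurableI.
  rewrite measureU// ?fineD ?fin_num_measure//.
  by apply/seteqP; split=> w // [[_ ?] []].
(* The count cannot reach [n.+1] in [n] iterations; without this top term the two sums align after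
   an index shift. *)
have a_out : a n.+1 - b n.+1 = 0.
  have C0 : C n.+1 = set0.
    apply/seteqP; split=> w //= cw.
    by have := true_count_le Tr n w; rewrite cw ltnn.
  by rewrite /a /b C0 set0I measure0 subrr.
rewrite (eq_bigr (fun m : 'I_n.+2 => y ^+ m * (a m - b m) +
    y ^+ m * (if (m : nat) is m'.+1 then b m' else 0))); last first.
  by move=> m _; rewrite stepE mulrDr.
rewrite big_split/= big_ord_recr/= a_out mulr0 addr0.
rewrite [X in _ + X]big_ord_recl/= mulr0 add0r -big_split/=.
rewrite exprS; apply: le_trans (ler_wpM2l r0 IH).
rewrite mulr_sumr; apply: ler_sum => m _.
have := cond n m (ltnSn n); rewrite /= -/(C m) -/(a m) -/(b m) => ab.
rewrite /bump/= add1n exprS.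
have ym : 0 <= y ^+ m by rewrite exprn_ge0.
have : 0 <= y ^+ m * ((1 - y) * (b m - q * a m)).
  by rewrite !mulr_ge0 ?subr_ge0.
rewrite -/(a m); lra.
Qed.

(* Markov's inequality applied to [expR (- x)] to the power of the count. *)
Lemma chernoff_lower_tail (R : realType) (disp : measure_display)
    (T : measurableType disp) (P : probability T R) (Tr : nat -> set T)
    (N : nat) (q x : R) :
  0 <= q <= 1 -> 0 <= x ->
  (forall k, (k < N)%N -> measurable (Tr k)) ->
  (forall k m, (k < N)%N -> let A := true_count Tr k @^-1` [set m] in
    q * fine (P A) <= fine (P (A `&` Tr k))) ->
  fine (P [set w | (true_count Tr N w)%:R <= q * (1 - x) * N%:R]) <=
    expR (- (x ^+ 2 / 2 * q * N%:R)).
Proof.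
move=> q01 x0 mTr cond; have /andP[q0 q1] := q01.
set r := q * (1 - x) * N%:R; set A := [set w | _].
have mC m : measurable (true_count Tr N @^-1` [set m]) by exact: measurable_true_count.
pose c w : 'I_N.+1 := inord (true_count Tr N w).
have cE (m : 'I_N.+1) : c @^-1` [set m] = true_count Tr N @^-1` [set (m : nat)].
  apply/seteqP; split=> w /= cw.
    by rewrite -cw inordK// ltnS true_count_le.
  by apply: val_inj; rewrite /= inordK ?cw.
have mA : measurable A.
  rewrite (_ : A = \bigcup_(m in [set m : nat | m%:R <= r]) (true_count Tr N @^-1` [set m])).
    exact: bigcup_measurable.
  apply/seteqP; split=> [w Aw|w [m /= mr wm]]; first by exists (true_count Tr N w).
  by rewrite /A/= wm.
rewrite (fine_probability_fibers P (c := c) mA); last by move=> m; rewrite cE.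
apply: le_trans (chernoff_exponent N q01 x0).
have ex0 := expR_gt0 (- x).
have ex1 : expR (- x) <= 1 by rewrite -expR0 ler_expR oppr_le0.
have h0 : 0 <= 1 - q * (1 - expR (- x)) by nra.
have y01 : 0 <= expR (- x) <= 1 by rewrite ltW.
have := generating_function_decay y01 mTr cond h0.
rewrite -(ler_pM2l (expR_gt0 (x * r))) /r; apply: le_trans.
rewrite -/r mulr_sumr; apply: ler_sum => m _; rewrite cE.
(* Levels above [r] miss [A]; on the others the weight [expR (x * (r - m))] is at least one. *)
have [mr|mr] := leP (m%:R : R) r; last first.
  rewrite (_ : _ `&` _ = set0) ?measure0/=.
    by rewrite !mulr_ge0 ?exprn_ge0 ?(ltW ex0) ?(ltW (expR_gt0 _))// fine_ge0.
  by apply/seteqP; split=> w //= [+ wm]; rewrite /A/= wm leNgt mr.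
apply: (@le_trans _ _ (fine (P (true_count Tr N @^-1` [set (m : nat)])))).
  by apply: fine_probability_le => //; exact: measurableI.
rewrite mulrA ler_peMl ?fine_ge0// -expRM_natl -expRD -[X in X <= _]expR0 ler_expR.
have : 0 <= x * (r - m%:R) by rewrite mulr_ge0// subr_ge0.
lra.
Qed.

(** * True iterations and their probability given the past *)

Lemma measurable_set1_mx (R : realType) (m n : nat) (M : 'M[R]_(m, n)) :
  measurable ([set M] : set (borel_mx R m n)).
Proof.
rewrite (_ : [set M] = \bigcap_(ij in [set: 'I_m * 'I_n])
    ((fun N : 'M[R]_(m, n) => N ij.1 ij.2) @^-1` [set M ij.1 ij.2])).
  apply: fin_bigcap_measurable => // [[i j] _].
  have := @measurable_mx_entry R _ (borel_mx R m n) m n id i j (@measurable_id _ _ _).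
  by move=> /(_ measurableT [set M i j] (measurable_set1 _)); rewrite setTI.
apply/seteqP; split=> [_ -> [] //|N NM]; apply/matrixP => i j.
exact: (NM (i, j)).
Qed.

(** That [S t] is a hashing matrix holds only almost surely under the law; building it into the
    event supplies the sample [w] pointwise, as [norm2_hash_mx] requires. *)
Definition true_event (R : realType) (T : Type) (d l : nat)
    (S : T -> 'M[R]_(l, d)) (K : T -> set 'M[R]_(l, d)) : set T :=
  [set t | exists w, [/\ w \in hash_samples d l, S t = hash_mx R w
                       & K t (S t)]].

(** With finitely many samples, measurability of [K] is needed only at each fixed hashing matrix. *)
Lemma measurable_true_event (R : realType) (disp : measure_display)
    (T : measurableType disp) (d l : nat) (S : T -> 'M[R]_(l, d))
    (K : T -> set 'M[R]_(l, d)) :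
  measurable_fun setT (S : T -> borel_mx R l d) ->
  (forall w, measurable [set t | K t (hash_mx R w)]) ->
  measurable (true_event S K).
Proof.
move=> mS mK; rewrite (_ : true_event S K =
    \bigcup_(w in [set` hash_samples d l])
      (S @^-1` [set hash_mx R w] `&` [set t | K t (hash_mx R w)])).
  apply: fin_bigcup_measurable => // w _; apply: measurableI => //.
  by rewrite -[X in measurable X]setTI; apply: mS => //; exact: measurable_set1_mx.
apply/seteqP; split=> [t [w [ws Sw KS]]|t [w /= ws [Sw Kw]]].
  by exists w => //; split=> //=; rewrite -Sw.
by exists w; rewrite Sw; split.
Qed.

(* Conditionally on the set of samples that are good at [t], an event of the
   past, the independent draw falls among them with probability at least [q]. *)
Lemma conditional_success (R : realType) (disp : measure_display)
    (T : measurableType disp) (P : probability T R) (d l : nat)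
    (S : T -> 'M[R]_(l, d)) (K : T -> set 'M[R]_(l, d)) (past : set (set T))
    (q : R) (E : set T) :
  measurable_fun setT (S : T -> borel_mx R l d) ->
  (forall A : set (borel_mx R l d), measurable A ->
    P (S @^-1` A) = stable_hashing_law A) ->
  <<s past >> `<=` measurable ->
  (forall E F : set T, <<s past >> E ->
    g_sigma_algebra_preimage (S : T -> borel_mx R l d) F ->
    P (E `&` F) = (P E * P F)%E) ->
  (forall w, <<s past >> [set t | K t (hash_mx R w)]) ->
  (forall t, (q%:E <= stable_hashing_law (K t))%E) ->
  <<s past >> E ->
  q * fine (P E) <= fine (P (E `&` true_event S K)).
Proof.
move=> mS law sub indep mK qlaw pE.
(* The good samples at [t] form a finite-valued function of the past; on each of its fibres the good
   set is a constant [G]. *)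
pose c t : {set hash_sample d l} := [set w in hash_samples d l | hash_mx R w \in K t].
pose hit (G : {set hash_sample d l}) : set (borel_mx R l d) :=
  \bigcup_(w in [set` G]) [set hash_mx R w].
have mhit G : measurable (hit G).
  by apply: fin_bigcup_measurable => // w _; exact: measurable_set1_mx.
have mcw w : <<s past >> [set t | w \in c t].
  have [ws|ws] := boolP (w \in hash_samples d l).
    rewrite (_ : [set _ | _] = [set t | K t (hash_mx R w)])//.
    by apply/seteqP; split=> t /=; rewrite inE ws /=; [exact: set_mem|exact: mem_set].
  rewrite (_ : [set _ | _] = set0); first exact: (@measurable0 _ (g_sigma_algebraType past)).
  by apply/seteqP; split=> t //=; rewrite inE (negbTE ws).
have pc G : <<s past >> (c @^-1` [set G]).
  rewrite (_ : c @^-1` [set G] = \bigcap_(w in [set: hash_sample d l])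
     (if w \in G then [set t | w \in c t] else ~` [set t | w \in c t])).
    apply: (@fin_bigcap_measurable _ (g_sigma_algebraType past)) => // w _.
    by case: ifP => _; [exact: mcw|apply: measurableC; exact: mcw].
  apply/seteqP; split=> [t /= <- w _|t /= h].
    by case: ifP => // /negbT/negP.
  apply/setP => w; have := h w I; case: ifP => _ //=.
  by move=> /negP/negbTE.
have mE := sub _ pE.
have mTr : measurable (true_event S K).
  by apply: measurable_true_event => // w; exact: (sub _ (mK w)).
have mc G : measurable (c @^-1` [set G]) by exact: (sub _ (pc G)).
rewrite (fine_probability_fibers P mE mc).
rewrite (fine_probability_fibers P (measurableI _ _ mE mTr) mc) mulr_sumr.
apply: ler_sum => G _.
(* A point [t0] of a nonempty fibre transfers the bound [qlaw t0] to the fixed set [hit G]. *)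
have [-> |/set0P[t0 ct0]] := eqVneq (c @^-1` [set G]) set0.
  by rewrite !setI0 measure0 mulr0.
have pEc : <<s past >> (E `&` c @^-1` [set G]).
  exact: (@measurableI _ (g_sigma_algebraType past) _ _ pE (pc G)).
have mEc := sub _ pEc.
have mShit : measurable (S @^-1` hit G).
  by rewrite -[X in measurable X]setTI; exact: mS.
have hitG : (q%:E <= P (S @^-1` hit G))%E.
  rewrite law//; apply: le_trans (qlaw t0) _; rewrite /stable_hashing_law lee_fin.
  rewrite ler_wpM2r ?invr_ge0// ler_nat; apply: subset_leq_card.
  apply/fintype.subsetP => w; rewrite !inE => /andP[ws Kw]; rewrite ws/=.
  by apply/mem_set; exists w => //=; rewrite -ct0 !inE ws.
have -> : q * fine (P (E `&` c @^-1` [set G])) =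
    fine (P (E `&` c @^-1` [set G]) * q%:E).
  by rewrite fineM ?fin_num_measure//= mulrC.
apply: (@le_trans _ _ (fine (P ((E `&` c @^-1` [set G]) `&` S @^-1` hit G)))).
  rewrite (indep (E `&` c @^-1` [set G]))//; last first.
    by exists (hit G) => //; rewrite setTI.
  apply: fine_le; rewrite ?fin_numM ?fin_num_measure//.
  by apply: lee_wpmul2l => //; exact: measure_ge0.
apply: fine_probability_le; [exact: measurableI| |].
  by apply: measurableI => //; exact: measurableI.
move=> t [[Et ct] [w /= wG Sw]]; split=> //; split=> //.
move: wG; rewrite -ct !inE => /andP[ws /set_mem Kw].
have {}Sw : S t = hash_mx R w := Sw.
by exists w; rewrite Sw inE; split.
Qed.

(** * Conclusion *)

(** Indices are integers: if none up to [N] qualifies, the infimum is at least [N.+1], which also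
    covers the value [+oo] of the empty set. *)
Lemma N_eps_le (R : realType) (T : Type) (d : nat) (f : 'cV[R]_d -> R)
    (eps : R) (x : nat -> T -> 'cV[R]_d) (N : nat) :
  [set w | (N_eps f eps x w <= N%:R%:E)%E] =
  \bigcup_(k in [set k | (k <= N)%N]) [set w | norm2 (grad f (x k w)) <= eps].
Proof.
apply/seteqP; split=> w /=; last first.
  move=> [k /= kN xk]; apply: (@le_trans _ _ (k%:R%:E)); last by rewrite lee_fin ler_nat.
  by apply: ereal_inf_lbound; exists k.
move=> infN; apply: contrapT => noE.
have : (N.+1%:R%:E <= N_eps f eps x w)%E.
  apply: le_ereal_inf_tmp => _ [k /= xk <-]; rewrite lee_fin ler_nat ltnNge.
  by apply/negP => kN; apply: noE; exists k.
by move=> /le_trans /(_ infN); rewrite lee_fin ler_nat ltnn.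
Qed.

Definition embeds (R : realType) (d l : nat) (epsS : R) (y : 'cV[R]_d) :
    set 'M[R]_(l, d) :=
  [set S | (1 - epsS) * norm2 y ^+ 2 <= norm2 (S *m y) ^+ 2].

Lemma measurable_le_set (R : realType) (disp : measure_display)
    (T : measurableType disp) (g h : T -> R) :
  measurable_fun setT g -> measurable_fun setT h ->
  measurable [set t | g t <= h t].
Proof.
move=> mg mh; rewrite -[X in measurable X]setTI.
by have := measurable_fun_ler mg mh => /(_ measurableT [set true] I).
Qed.

Lemma measurable_embeds (R : realType) (disp : measure_display)
    (T : measurableType disp) (d l : nat) (epsS : R) (y : T -> 'cV[R]_d)
    (S : 'M[R]_(l, d)) :
  measurable_fun setT (y : T -> borel_mx R d 1) ->
  measurable [set t | embeds epsS (y t) S].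
Proof.
move=> my; apply: measurable_le_set.
  apply: measurable_funM => //; apply: measurable_funX; exact: measurable_norm2.
apply: measurable_funX; apply: measurable_norm2; apply: measurable_mulmx => //.
Qed.

(** The generators of [history], named so that [g_sigma_algebraType] turns the history into a
    measurable structure on [T]. *)
Definition history_gen (R : realType) (disp : measure_display)
    (T : measurableType disp) (d l : nat) (S : nat -> T -> 'M[R]_(l, d))
    (B : nat -> T -> 'M[R]_d) (s : nat -> T -> 'cV[R]_l) (k : nat) :
    set (set T) :=
  \bigcup_(j in [set j | (j < k)%N])
    (g_sigma_algebra_preimage (S j : T -> borel_mx R l d)
     `|` g_sigma_algebra_preimage (B j : T -> borel_mx R d d)
     `|` g_sigma_algebra_preimage (s j : T -> borel_mx R l 1)).

Lemma measurable_history_gen (R : realType) (disp : measure_display)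
    (T : measurableType disp) (d l : nat) (S : nat -> T -> 'M[R]_(l, d))
    (B : nat -> T -> 'M[R]_d) (s : nat -> T -> 'cV[R]_l) (j k : nat) :
  (j < k)%N -> let H := g_sigma_algebraType (history_gen S B s k) in
  [/\ measurable_fun setT (S j : H -> borel_mx R l d),
      measurable_fun setT (B j : H -> borel_mx R d d) &
      measurable_fun setT (s j : H -> borel_mx R l 1)].
Proof.
by move=> jk H; split=> _ A mA; apply: sub_sigma_algebra; exists j => //;
  [left; left|left; right|right]; exists A.
Qed.

Lemma history_measurable (R : realType) (disp : measure_display)
    (T : measurableType disp) (d l : nat) (S : nat -> T -> 'M[R]_(l, d))
    (B : nat -> T -> 'M[R]_d) (s : nat -> T -> 'cV[R]_l) (k : nat) :
  (forall j, (j < k)%N -> measurable_fun setT (S j : T -> borel_mx R l d)) ->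
  (forall j, (j < k)%N -> measurable_fun setT (B j : T -> borel_mx R d d)) ->
  (forall j, (j < k)%N -> measurable_fun setT (s j : T -> borel_mx R l 1)) ->
  <<s history_gen S B s k >> `<=` measurable.
Proof.
move=> mS mB ms; apply: smallest_sub; first exact: sigma_algebra_measurable.
move=> _ [j /= jk [[]|]] [A mA <-]; [exact: mS|exact: mB|exact: ms].
Qed.

Theorem theorem4p5p2 (R : realType) (C3 : R) (hC3 : 0 < C3)
  (d l : nat) (hl : (0 < l)%N) (hld : (l < d)%N)
  (f : 'cV[R]_d -> R) (L fstar : R)
  (hf : forall x, differentiable f x)
  (hf1 : continuous (grad f))
  (hL : forall x y, norm2 (grad f x - grad f y) <= L * norm2 (x - y))
  (hmin : range f fstar /\ lbound (range f) fstar)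
  (gamma1 : R) (hgamma1 : 0 < gamma1 < 1)
  (c : nat) (hc : (0 < c)%N)
  (theta : R) (htheta : 0 < theta < 1)
  (alphamax Bmax kappaT : R)
  (halphamax : 0 < alphamax) (hBmax : 0 < Bmax) (hkappaT : 0 <= kappaT)
  (x0 : 'cV[R]_d) (p : nat) (hp : (0 < p)%N)
  (alpha0 : R) (halpha0 : alpha0 = alphamax * gamma1 ^+ p)
  (eps delta1 epsS : R)
  (heps : 0 < eps) (hdelta1 : 0 < delta1) (hepsS : 0 < epsS < 3 / 4)
  (hembed : stable_hashing_embedding C3 l f epsS)
  (deltaS : R) (hdeltaS : deltaS = hash_failure C3 l epsS)
  (hdeltaSc : deltaS < c%:R / (c%:R + 1) ^+ 2)
  (hpos : 0 < ((1 - deltaS) * (1 - delta1) - 1 + c%:R / (c%:R + 1) ^+ 2)^-1)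
  (tau : int) (htau : tau = tau_alpha gamma1 c theta L Bmax alpha0)
  (disp : measure_display) (T : measurableType disp) (P : probability T R)
  (S : nat -> T -> 'M[R]_(l, d)) (B : nat -> T -> 'M[R]_d)
  (s : nat -> T -> 'cV[R]_l) (x : nat -> T -> 'cV[R]_d)
  (alpha : nat -> T -> R)
  (N : nat)
  (hrun : rsqr_run P (@stable_hashing_law R d l) f
            gamma1 c theta alphamax Bmax kappaT alpha0 x0 S B s x alpha N)
  (hN : N%:R >=
     ((1 - deltaS) * (1 - delta1) - 1 + c%:R / (c%:R + 1) ^+ 2)^-1
     * ((f x0 - fstar)
          / h_decrease d l theta alphamax Bmax kappaT epsS eps
              (alpha0 * gamma1 ^ (c%:Z + tau))
        + tau%:~R / (1 + c%:R))) :
  (P [set w | (N_eps f eps x w <= N%:R%:E)%E]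
   >= (1 - expR (- (delta1 ^+ 2 / 2 * (1 - deltaS) * N%:R)))%:E)%E.
Proof.
have /andP[e0 e34] := hepsS.
have d0 : (0 < d)%N by exact: leq_ltn_trans hld.
have fc : continuous f by move=> y; exact: differentiable_continuous.
have [[g0 g1] [th0 th1]] := (andP hgamma1, andP htheta).
have [mS mB ms law indep x0E al0E step] := hrun.
have x0w w : f (x 0%N w) = f x0 by rewrite x0E.
have dS0 : 0 < deltaS by rewrite hdeltaS expR_gt0.
(* By [(c - 1) ^+ 2 >= 0]; this supplies the condition [deltaS < 1 / 2] of the embedding
   hypothesis. *)
have dS4 : deltaS < 1 / 4.
  apply: lt_le_trans hdeltaSc _.
  rewrite ler_pdivrMr ?exprn_gt0 ?ltr_wpDl//.
  by have := sqr_ge0 (c%:R - 1 : R); lra.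
have q01 : 0 <= 1 - deltaS <= 1 by lra.
have a00 : 0 < alpha0 by rewrite halpha0 mulr_gt0 ?exprn_gt0.
have L0 := lipschitz_const_ge0 d0 hL.
have alow0 : 0 < alpha_low theta L Bmax.
  by rewrite divr_gt0 ?subr_gt0// ltr_wpDl.
have [t tE talow] := tau_alphaP c hgamma1 a00 alow0.
rewrite {}tE in htau; subst tau.
pose K k w : set 'M[R]_(l, d) := embeds epsS (grad f (x k w)).
pose Tr k := true_event (S k) (K k).
have xE k w : (k < N)%N -> x k.+1 w =
    if sufficient_decrease f theta (x k w) (S k w) (B k w) (s k w)
    then x k w + (S k w)^T *m s k w else x k w.
  by move=> kN; have [] := step k kN w.
have mx j k : (j <= k)%N -> (k <= N)%N -> measurable_fun setT
    (x j : g_sigma_algebraType (history_gen S B s k) -> borel_mx R d 1).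
  move=> jk kN.
  apply: (@measurable_iterates R _ (g_sigma_algebraType (history_gen S B s k))
    d l f theta S B s x x0 j fc hf1 _ _ _ x0E) => i ij; last first.
    by move=> w; apply: xE; exact: leq_trans (leq_trans ij jk) kN.
  - by have [] := measurable_history_gen S B s (leq_trans ij jk).
  - by have [] := measurable_history_gen S B s (leq_trans ij jk).
  - by have [] := measurable_history_gen S B s (leq_trans ij jk).
have mgrad j k : (j <= k)%N -> (k <= N)%N -> measurable_fun setT
    ((fun w => grad f (x j w)) :
      g_sigma_algebraType (history_gen S B s k) -> borel_mx R d 1).
  by move=> jk kN; apply: measurable_continuous_comp_mx => //; exact: mx.
have mK j k w : (j <= k)%N -> (k <= N)%N ->
    <<s history_gen S B s k >> [set t | K j t (hash_mx R w)].
  by move=> jk kN; have := measurable_embeds epsS (hash_mx R w) (mgrad j k jk kN).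
have mTr j k : (j < k)%N -> (k <= N)%N -> <<s history_gen S B s k >> (Tr j).
  move=> jk kN.
  apply: (@measurable_true_event _ _ (g_sigma_algebraType (history_gen S B s k))).
    by have [] := measurable_history_gen S B s jk.
  by move=> w; apply: mK => //; exact: ltnW.
have past k : (k <= N)%N -> <<s history_gen S B s k >> `<=` measurable.
  move=> kN; apply: history_measurable => j jk; [apply: mS|apply: mB|apply: ms];
    exact: leq_trans kN.
have mTrT k : (k < N)%N -> measurable (Tr k).
  by move=> kN; apply: (past k.+1 kN); exact: mTr.
have mcount k m : (k <= N)%N ->
    <<s history_gen S B s k >> (true_count Tr k @^-1` [set m]).
  move=> kN.
  apply: (@measurable_true_count _ (g_sigma_algebraType (history_gen S B s k))).
  by move=> j jk; exact: mTr.
(* Level sets of the count of earlier true iterations belong to the history, so the independence of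
   the draw [S k] applies to them. *)
have cond k m : (k < N)%N -> let A := true_count Tr k @^-1` [set m] in
    (1 - deltaS) * fine (P A) <= fine (P (A `&` Tr k)).
  move=> kN; apply: (conditional_success (mS k kN) (law k kN) (past k (ltnW kN))
    (indep k kN)).
  - by move=> w; apply: mK => //; exact: ltnW.
  - move=> w; have := hembed hepsS; rewrite -hdeltaS dS0/=; apply; first lra.
    by exists (x k w).
  - by apply: mcount; exact: ltnW.
have tail := chernoff_lower_tail q01 (ltW hdelta1) mTrT cond.
set bad := [set w | _] in tail.
have k0 : 0 < (1 - deltaS) * (1 - delta1) - 1 + c%:R / (c%:R + 1) ^+ 2.
  by rewrite -invr_gt0.
rewrite N_eps_le; set Ev := \bigcup_(k in _) _.
have mEv : measurable Ev.
  apply: bigcup_measurable => k /= kN.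
  apply: measurable_le_set => //; apply: (measurable_norm2 (u := fun w => grad f (x k w))).
  move=> _ A mA; have := mgrad k k (leqnn k) kN measurableT A mA.
  exact: (past k kN).
have mbad : measurable bad.
  rewrite (_ : bad = \bigcup_(m in [set m : nat | m%:R <= (1 - deltaS) * (1 - delta1) * N%:R])
      (true_count Tr N @^-1` [set m])).
    by apply: bigcup_measurable => m _; apply: (past N (leqnn N)); exact: mcount.
  apply/seteqP; split=> [w bw|w [m /= mr wm]]; first by exists (true_count Tr N w).
  by rewrite /bad/= wm.
(* The deterministic part, run by run: if no iterate up to [N] is stationary, the count of true
   iterations is small. *)
have bad_of_Ev : ~` Ev `<=` bad.
  move=> w nEv.
  have big k : (k < N)%N -> eps < norm2 (grad f (x k w)).
    move=> kN; rewrite ltNge; apply/negP => xk; apply: nEv.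
    by exists k => //=; exact: ltnW.
  have am0 : 0 < alphamax * gamma1 ^+ (p + t) by rewrite mulr_gt0 ?exprn_gt0.
  (* The argument of [h_decrease] lies [c] grid steps below the floor [alphamax * gamma1 ^+ (p + t)]
     of the step parameters, hence is a valid lower bound. *)
  have aE : alpha0 * gamma1 ^ (c%:Z + t) = alphamax * gamma1 ^+ (p + t + c).
    by rewrite -PoszD -exprnP halpha0 -mulrA -exprD [(c + t)%N]addnC addnA.
  have a0 : 0 < alpha0 * gamma1 ^ (c%:Z + t) by rewrite aE mulr_gt0 ?exprn_gt0.
  have ale : alpha0 * gamma1 ^ (c%:Z + t) <= alphamax * gamma1 ^+ (p + t).
    by rewrite aE ler_pM2l// ler_wiXn2l ?(ltW g0) ?(ltW g1)// leq_addr.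
  have al : alphamax * gamma1 ^+ (p + t) <= alpha_low theta L Bmax.
    by rewrite exprD mulrA -halpha0.
  have e1 : epsS < 1 by lra.
  have trP k : (k < N)%N -> `[< Tr k w >] -> exists w', [/\ w' \in hash_samples d l,
      S k w = hash_mx R w' & (1 - epsS) * norm2 (grad f (x k w)) ^+ 2
      <= norm2 (S k w *m grad f (x k w)) ^+ 2].
    by move=> kN /asboolP.
  have al0w : alpha 0%N w = alphamax * gamma1 ^+ p by rewrite al0E.
  have [U [V [W [hU hUV hcnt hW]]]] := trajectory_counts d0 hf hL hgamma1 htheta
    halphamax hBmax hkappaT e1 heps al a0 ale al0w
    (fun k kN => step k kN w) trP big.
  have hgt0 := h_decrease_gt0 hl d0 th0 halphamax hBmax hkappaT e1 heps a0.
  apply: (true_count_bound hU hUV hcnt hgt0 _ k0 hN).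
  by apply: le_trans hW _; rewrite x0w lerD2l lerN2; apply: hmin.2; exists (x N w).
have PEv : fine (P Ev) = 1 - fine (P (~` Ev)).
  rewrite -[in LHS](setCK Ev) (probability_setC P (measurableC mEv)).
  by rewrite fineB ?fin_num_measure//; exact: measurableC.
rewrite -(fineK (fin_num_measure P _ mEv)) lee_fin PEv lerD2l lerN2.
apply: le_trans tail; apply: fine_probability_le => //; exact: measurableC.
Qed.
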